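(* Let $p(\cdot)\in\mathcal P(\mathbb R^n)$ satisfy $p(\cdot)\in LH_0(\mathbb R^n)\cap LH_\infty(\mathbb R^n)$ and $1<p^-\le p^+<\infty$, and let $w$ be a weight on $\mathbb R^n$. Then there exists a constant $C>0$ such that $$\int_{\mathbb R^n}\int_{\mathbb R^n}\frac{f(x)g(y)}{|x|^n+|y|^n}\,dx\,dy\le C\,\|fw\|_{p(\cdot)}\,\|gw^{-1}\|_{p'(\cdot)}$$ for all non-negative functions $f\in L^{p(\cdot)}_w(\mathbb R^n)$ and $g\in L^{p'(\cdot)}_{w^{-1}}(\mathbb R^n)$ (with $C$ independent of $f$ and $g$) if and only if $w\in A_{p(\cdot),0}$.
   Context: $\mathcal P(\mathbb R^n)$ is the set of bounded measurable functions $p(\cdot):\mathbb R^n\to[1,\infty)$; $p^-=\inf_{x\in\mathbb R^n}p(x)$ and $p^+=\sup_{x\in\mathbb R^n}p(x)$. The conjugate exponent is defined pointwise by $1/p(x)+1/p'(x)=1$. For $r(\cdot)\in\mathcal P(\mathbb R^n)$ and measurable $f$, $\|f\|_{r(\cdot)}=\inf\{\mu>0:\int_{\mathbb R^n}(|f(x)|/\mu)^{r(x)}\,dx\le1\}\in[0,\infty]$. $p(\cdot)\in LH_0(\mathbb R^n)$ means there are $C_0>0$, $p_0\ge1$ with $|p(x)-p_0|\le \frac{C_0}{-\log|x|}$ for all $0<|x|<1/2$. $p(\cdot)\in LH_\infty(\mathbb R^n)$ means there are $C_\infty>0$, $p_\infty\ge1$ with $|p(x)-p_\infty|\le\frac{C_\infty}{\log(e+|x|)}$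 for all $x\in\mathbb R^n$. A weight is a non-negative, locally integrable function $w$ on $\mathbb R^n$ with $0<w(x)<\infty$ a.e. $L^{p(\cdot)}_w(\mathbb R^n)$ is the set of measurable $f$ with $\|fw\|_{p(\cdot)}<\infty$, and $L^{p'(\cdot)}_{w^{-1}}(\mathbb R^n)$ is the set of measurable $g$ with $\|gw^{-1}\|_{p'(\cdot)}<\infty$. $w\in A_{p(\cdot),0}$ means there is a constant $C>0$ such that $\|w\chi_{B(0,b)}\|_{p(\cdot)}\|w^{-1}\chi_{B(0,b)}\|_{p'(\cdot)}\le Cb^n$ for every $b>0$, where $B(0,b)$ is the ball of radius $b$ centered at the origin. *)

(* Defs.v *)
From HB Require Import structures.
From mathcomp Require Import all_boot all_order all_algebra.
From mathcomp Require Import all_classical all_reals all_analysis.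
From mathcomp Require Import measurable_realfun.

Set Implicit Arguments.
Unset Strict Implicit.
Unset Printing Implicit Defensive.

Import Order.TTheory GRing.Theory Num.Theory.
Import numFieldNormedType.Exports.

Local Open Scope classical_set_scope.
Local Open Scope ring_scope.
Local Open Scope ereal_scope.

Section lebesgue_cons.
Context {R : realType} {n : nat}.
Variable m : {sigma_finite_measure set (n.-tuple (measurableTypeR R)) -> \bar R}.

Definition tcons (z : measurableTypeR R * n.-tuple (measurableTypeR R)) :
  n.+1.-tuple (measurableTypeR R) := [tuple of z.1 :: z.2].

Lemma measurable_tcons : measurable_fun [set: _] tcons.
Proof. exact: measurable_cons. Qed.

Definition lebesgue_cons : set (n.+1.-tuple (measurableTypeR R)) -> \bar R :=
  pushforward (lebesgue_measure \x m) tcons.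

Let lebesgue_cons0 : lebesgue_cons set0 = 0.
Proof. by rewrite /lebesgue_cons /pushforward preimage_set0 measure0. Qed.

Let lebesgue_cons_ge0 A : 0 <= lebesgue_cons A.
Proof. exact: (measure_ge0 (lebesgue_measure \x m)). Qed.

Let lebesgue_cons_sigma_additive : semi_sigma_additive lebesgue_cons.
Proof.
move=> F mF tF mUF; rewrite /lebesgue_cons /pushforward preimage_bigcup.
have mtcons A : measurable A -> measurable (tcons @^-1` A).
  by move=> mA; rewrite -[X in measurable X]setTI; exact: measurable_tcons.
apply: (@measure_semi_sigma_additive _ _ _ (lebesgue_measure \x m)%E (fun k => tcons @^-1` F k)).
- by move=> k; exact: mtcons (mF k).
- apply/trivIsetP => /= i j _ _ ij; rewrite -preimage_setI.
  by move/trivIsetP : tF => /(_ _ _ _ _ ij) ->//; rewrite preimage_set0.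
- by rewrite -preimage_bigcup; exact: mtcons.
Qed.

HB.instance Definition _ := isMeasure.Build _ _ _ lebesgue_cons
  lebesgue_cons0 lebesgue_cons_ge0 lebesgue_cons_sigma_additive.

Let lebesgue_cons_sigma_finite : sigma_finite setT lebesgue_cons.
Proof.
have /sigma_finiteP[F [TF ndF Foo]] :=
  sigma_finiteT (@lebesgue_measure R).
have /sigma_finiteP[G [TG ndG Goo]] := sigma_finiteT m.
pose u (t : n.+1.-tuple (measurableTypeR R)) :
  measurableTypeR R * n.-tuple (measurableTypeR R) :=
  (thead t, [tuple of behead t]).
have m_u : measurable_fun [set: n.+1.-tuple (measurableTypeR R)] u.
  apply: measurable_fun_pair; first exact: measurable_tnth.
  exact: measurable_behead.
have uK : cancel tcons u.
  by move=> [x t]; congr pair; apply/val_inj.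
exists (fun k => u @^-1` (F k `*` G k)).
  rewrite -preimage_bigcup -(preimage_setT u); congr (_ @^-1` _).
  apply/esym; rewrite predeqE => -[x y]; split => // _.
  have [i _ Fx] : (\bigcup_i F i) x by rewrite -TF.
  have [j _ Gy] : (\bigcup_i G i) y by rewrite -TG.
  exists (maxn i j) => //; split => /=.
  - by move: x Fx; exact/subsetPset/ndF/leq_maxl.
  - by move: y Gy; exact/subsetPset/ndG/leq_maxr.
move=> k; have [mFk Fkoo] := Foo k; have [mGk Gkoo] := Goo k; split.
  rewrite -[X in measurable X]setTI; apply: m_u => //.
  exact: measurableX.
rewrite /lebesgue_cons /pushforward (_ : tcons @^-1` _ = F k `*` G k).
  by rewrite product_measure1E// lte_mul_pinfty// ge0_fin_numE.
by rewrite -comp_preimage (_ : u \o tcons = id)//; apply/funext => z; exact: uK.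
Qed.

HB.instance Definition _ := Measure_isSigmaFinite.Build _ _ _ lebesgue_cons
  lebesgue_cons_sigma_finite.

End lebesgue_cons.

(* Lebesgue measure on the Borel sets, as an n-fold product of Lebesgue measures
   on the line; dimension 0 is the unit mass of a point. *)
Fixpoint lebesgue_borel (R : realType) (n : nat) :
    {sigma_finite_measure set (n.-tuple (measurableTypeR R)) -> \bar R} :=
  match n return
    {sigma_finite_measure set (n.-tuple (measurableTypeR R)) -> \bar R} with
  | 0 => dirac ([tuple] : 0.-tuple (measurableTypeR R))
  | n'.+1 => lebesgue_cons (lebesgue_borel R n')
  end.

Definition Rn (R : realType) (n : nat) : Type := n.-tuple (measurableTypeR R).

Definition lebesgue (R : realType) (n : nat) : set (Rn R n) -> \bar R :=
  @completed_measure_extension _ _ _ (lebesgue_borel R n).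
Arguments lebesgue : clear implicits.

Definition Rn_display (R : realType) (n : nat) : measure_display :=
  caratheodory_display (lebesgue_borel R n)^*%mu.

(* The measurable sets of [Rn R n] are the Lebesgue measurable ones, not only the
   Borel ones of the underlying tuples. *)
HB.instance Definition _ (R : realType) (n : nat) := Pointed.on (Rn R n).
HB.instance Definition _ (R : realType) (n : nat) :=
  @isMeasurable.Build (Rn_display R n) (Rn R n)
    (lebesgue_borel R n)^*%mu.-caratheodory
    (caratheodory_measurable_set0 _)
    (@caratheodory_measurable_setC _ _ _)
    (@caratheodory_measurable_bigcup _ _ _).

HB.instance Definition _ (R : realType) (n : nat) :=
  Measure.copy (lebesgue R n)
    (@completed_measure_extension _ _ _ (lebesgue_borel R n)).

Lemma lebesgue_sigma_finite (R : realType) (n : nat) :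
  sigma_finite setT (lebesgue R n).
Proof.
by apply: completed_measure_extension_sigma_finite; exact: sigma_finiteT.
Qed.

HB.instance Definition _ (R : realType) (n : nat) :=
  Measure_isSigmaFinite.Build _ _ _ (lebesgue R n)
    (@lebesgue_sigma_finite R n).

Section variable_lebesgue.
Context {R : realType} {n : nat}.
Local Notation mu := (lebesgue R n).
Implicit Types (x : Rn R n) (p r : Rn R n -> R) (w f : Rn R n -> \bar R).

Definition pcoord (i : 'I_n) x : R := tnth (x : n.-tuple R) i.

(* Euclidean norm; the library's norm on row vectors is the sup norm. *)
Definition enorm x : R := Num.sqrt (\sum_(i < n) pcoord i x ^+ 2)%R.

Definition eball0 (b : R) : set (Rn R n) := [set x | (enorm x < b)%R].

Definition is_exponent p : Prop :=
  [/\ measurable_fun [set: Rn R n] p, forall x, (1 <= p x)%R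
    & has_ubound (range p)].

Definition exponent_inf p : \bar R := ereal_inf (range (EFin \o p)).
Definition exponent_sup p : \bar R := ereal_sup (range (EFin \o p)).

(* p' is real-valued only where 1 < p; [fine] sends the value +oo at p x = 1 to
   0, so [conjugate] is meaningful only for exponents with values in ]1, +oo[. *)
Definition conjugate p : Rn R n -> R :=
  fun x => fine (hoelder_conjugate (p x)%:E).

(* The infimum of the empty set is +oo. *)
Definition vnorm r f : \bar R :=
  ereal_inf [set l%:E | l in
    [set l : R | (0 < l)%R /\ \int[mu]_x ((`|f x| / l%:E) `^ r x) <= 1]].

Definition LH0 p : Prop :=
  exists C0 p0 : R, [/\ (0 < C0)%R, (1 <= p0)%R &
    forall x, (0 < enorm x < 2^-1)%R ->
      (`|p x - p0| <= C0 / - ln (enorm x))%R].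

Definition LHoo p : Prop :=
  exists Coo poo : R, [/\ (0 < Coo)%R, (1 <= poo)%R &
    forall x, (`|p x - poo| <= Coo / ln (expR 1 + enorm x))%R].

(* Compactness is read in the space of row vectors, whose topology is the
   Euclidean one, because tuples carry no topology. *)
Definition ecompact (K : set (Rn R n)) : Prop :=
  compact [set (\row_(i < n) pcoord i x : 'rV[R]_n) | x in K].

Definition weight w : Prop :=
  [/\ measurable_fun [set: Rn R n] w,
      forall x, 0 <= w x,
      forall K, ecompact K -> \int[mu]_(x in K) w x < +oo
    & {ae mu, forall x, 0 < w x < +oo}].

(* Membership of f in L^{r(.)}_v. *)
Definition in_wLp r (v : Rn R n -> \bar R) (f : Rn R n -> R) : Prop :=
  measurable_fun [set: Rn R n] f /\ vnorm r (fun x => (f x)%:E * v x) < +oo.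

Definition Ap0 p w : Prop :=
  exists2 C : R, (0 < C)%R & forall b : R, (0 < b)%R ->
    vnorm p (fun x => w x * (\1_(eball0 b) x)%:E) *
    vnorm (conjugate p) (fun x => (w x)^-1 * (\1_(eball0 b) x)%:E)
      <= (C * b ^+ n)%:E.

End variable_lebesgue.

(* Main.v *)
Require Import Defs.
From HB Require Import structures.
From mathcomp Require Import all_boot all_order all_algebra.
From mathcomp Require Import all_classical all_reals all_analysis.
From mathcomp Require Import measurable_realfun.
From mathcomp Require Import ring lra zify.

Set Implicit Arguments.
Unset Strict Implicit.
Unset Printing Implicit Defensive.

Import Order.TTheory GRing.Theory Num.Theory.
Import numFieldNormedType.Exports.

Local Open Scope classical_set_scope.
Local Open Scope ring_scope.
Local Open Scope ereal_scope.

(** Necessity: test the form on functions supported in a ball [B] of radius [b],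
    where the kernel is at least [1 / (2 b^n)], and take near-extremizers of the
    two dual norms in the Luxemburg sense.

    Sufficiency: let [U1 j], [U2 j] be the norms of [w] and [1/w] on the ball of
    radius [2^(j+1)].  Young's inequality on the annulus [2^j <= |x| < 2^(j+1)],
    together with [U1 j * U2 j <= C 2^(jn)], shows that the annulus carries a fixed
    proportion of the norm of the ball, so [U1] and [U2] grow geometrically in [j].
    Thus the part of the form coming from the annuli of indices [j] and [k] is at
    most [C r^|j-k| a_j b_k] with [r < 1], where [a_j], [b_k] measure [f w] and
    [g / w] on the annuli.  By the two log-Hoelder conditions the exponent is, up to
    an error [O(1/|j|)], constant on the annulus of index [j], so one may take
    [a_j = M_j^(1/s)] and [b_k = M'_k^(1-1/s)], where [s] is the limit exponent
    (at the origin if [j < 0], at infinity otherwise) and [M_j], [M'_k] are the local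
    modulars increased by [2^-|j|]; both are summable.  The double sum converges by
    [M^t M'^(1-t) <= M + M'] when [j] and [k] have the same sign, and otherwise
    because [r^|j-k| = r^|j| r^|k|]. *)

(** * Integrals and modulars *)

(* No measurability of [f] and [g] is required: the inner integral of the bilinear form is
   never shown to be measurable in the outer variable. *)
Section nonneg_integral.
Context d (T : measurableType d) (R : realType).
Variable mu : {measure set T -> \bar R}.

Import HBNNSimple.

Lemma ge0_le_integral_nm (D : set T) (f g : T -> \bar R) :
  (forall x, D x -> 0 <= f x) -> (forall x, D x -> f x <= g x) ->
  \int[mu]_(x in D) f x <= \int[mu]_(x in D) g x.
Proof.
move=> f0 fg.
have g0 x : D x -> 0 <= g x by move=> Dx; exact: le_trans (f0 _ Dx) (fg _ Dx).
rewrite !ge0_integralE//; apply: ge_ereal_sup => /= _ [h hf <-].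
apply: ereal_sup_ubound; exists h => //= x; apply: le_trans (hf x) _.
by apply: lee_restrict.
Qed.

(** The integral of [f] is a supremum over simple functions below [f]. Each of these is measurable,
    so countable additivity applies to it, and on each [A k] it stays below [f]. *)
Lemma ge0_integral_le_bigcup (A : (set T)^nat) (f : T -> \bar R) :
  (forall k, measurable (A k)) -> trivIset setT A ->
  mu (~` \bigcup_k A k) = 0 -> (forall x, 0 <= f x) ->
  \int[mu]_x f x <= \sum_(k <oo) \int[mu]_(x in A k) f x.
Proof.
move=> mA tA N0 f0; rewrite ge0_integralTE//.
apply: ge_ereal_sup => /= _ [h hf <-].
have mU : measurable (\bigcup_k A k) by exact: bigcup_measurable.
have h0 x : 0 <= (h x)%:E by rewrite lee_fin fun_ge0.
have mh : measurable_fun setT (EFin \o h) by exact/measurable_EFinP.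
rewrite -integralT_nnsfun (ge0_negligible_integral (measurableC mU))//.
rewrite setTD setCK ge0_integral_bigcup//; last first.
  exact: measurable_funS mh.
apply: lee_nneseries => k _; first by move=> *; exact: integral_ge0.
by apply: ge0_le_integral_nm.
Qed.

End nonneg_integral.

Section modular.
Context d (T : measurableType d) (R : realType).
Variable mu : {measure set T -> \bar R}.
Implicit Types (q h : T -> R) (D : set T).

Lemma measurable_powR_var q h : (forall x, 0 < q x)%R ->
  measurable_fun setT q -> measurable_fun setT h ->
  measurable_fun setT (fun x => h x `^ q x)%R.
Proof.
move=> q0 mq mh.
have -> : (fun x => h x `^ q x)%R = (fun x => if h x == 0 then 0 else
    expR (q x * ln (h x)))%R.
  by apply/funext => x; rewrite /powR (gt_eqF (q0 x)).
apply: measurable_fun_ifT => //.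
- exact: measurable_fun_eqr.
- apply: measurableT_comp => //; apply: measurable_funM => //.
  exact: measurableT_comp.
Qed.

Definition modular D q h := \int[mu]_(x in D) (h x `^ q x)%:E.

Definition gauge D q h := ereal_inf [set l%:E | l in
  [set l : R | (0 < l)%R /\ modular D q (fun x => h x / l)%R <= 1]].

Lemma modular_ge0 D q h : 0 <= modular D q h.
Proof. by apply: integral_ge0 => x _; rewrite lee_fin powR_ge0. Qed.

Lemma gauge_ge0 D q h : 0 <= gauge D q h.
Proof.
by apply: le_ereal_inf_tmp => _ [l [l0 _] <-]; rewrite lee_fin ltW.
Qed.

Lemma gauge_le D q h (l : R) : (0 < l)%R ->
  modular D q (fun x => h x / l)%R <= 1 -> gauge D q h <= l%:E.
Proof. by move=> l0 hl; apply: ereal_inf_lbound; exists l. Qed.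

Lemma le_modular D q h1 h2 : (forall x, D x -> 0 <= q x)%R ->
  (forall x, D x -> 0 <= h1 x)%R -> (forall x, D x -> h1 x <= h2 x)%R ->
  modular D q h1 <= modular D q h2.
Proof.
move=> q0 h10 h12; apply: ge0_le_integral_nm => x Dx; rewrite lee_fin ?powR_ge0//.
by rewrite ge0_ler_powR ?nnegrE ?q0 ?h10 ?h12// (le_trans (h10 _ Dx)) ?h12.
Qed.

Lemma modular_gauge_lt D q h (l : R) : (forall x, D x -> 0 <= q x)%R ->
  (forall x, D x -> 0 <= h x)%R ->
  gauge D q h < l%:E -> modular D q (fun x => h x / l)%R <= 1.
Proof.
move=> q0 h0 /ereal_inf_lt[_ [k [k0 hk] <-]]; rewrite lte_fin => kl.
apply: le_trans hk; apply: le_modular => // x Dx.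
  by rewrite divr_ge0 ?h0// (le_trans (ltW k0)) ?ltW.
by rewrite ler_wpM2l ?h0// lef_pV2 ?posrE ?(ltW kl)// (lt_trans k0).
Qed.

Section measurable_modular.
Variables (D : set T) (q h : T -> R).
Hypotheses (mD : measurable D) (mq : measurable_fun setT q)
  (mh : measurable_fun setT h) (q1 : forall x, (1 <= q x)%R)
  (h0 : forall x, D x -> (0 <= h x)%R).

Let q0 x : (0 < q x)%R. Proof. exact: lt_le_trans (q1 x). Qed.

Lemma measurable_modular_integrand (h' : T -> R) : measurable_fun setT h' ->
  measurable_fun D (fun x => (h' x `^ q x)%:E).
Proof.
move=> mh'; apply: measurable_funTS; apply/measurable_EFinP.
exact: measurable_powR_var.
Qed.

Lemma modularZ_le (c : R) : (0 < c <= 1)%R ->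
  modular D q (fun x => h x * c)%R <= c%:E * modular D q h.
Proof.
move=> /andP[c0 c1]; rewrite -ge0_integralZl_EFin//; last 3 first.
- by move=> x _; rewrite lee_fin powR_ge0.
- exact: measurable_modular_integrand.
- exact: ltW.
apply: ge0_le_integral_nm => x Dx; first by rewrite lee_fin powR_ge0.
rewrite -EFinM lee_fin powRM ?h0 ?(ltW c0)// mulrC. rewrite ler_wpM2r ?powR_ge0//.
by rewrite ge1r_powR ?c0.
Qed.

Lemma modularZ_ge (c : R) : (1 <= c)%R ->
  c%:E * modular D q h <= modular D q (fun x => h x * c)%R.
Proof.
move=> c1; have c0 : (0 < c)%R by exact: lt_le_trans c1.
rewrite -ge0_integralZl_EFin//; last 3 first.
- by move=> x _; rewrite lee_fin powR_ge0.
- exact: measurable_modular_integrand.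
- exact: ltW.
apply: ge0_le_integral_nm => x Dx.
  by rewrite -EFinM lee_fin mulr_ge0 ?powR_ge0// ltW.
rewrite -EFinM lee_fin powRM ?h0 ?(ltW c0)// mulrC ler_wpM2l ?powR_ge0//.
by rewrite le1r_powR.
Qed.

Lemma modularZ_le_pow (h' : T -> R) (c Q : R) : measurable_fun setT h' ->
    (forall x, D x -> 0 <= h' x)%R -> (1 <= c)%R -> (forall x, q x <= Q)%R ->
  modular D q (fun x => h' x * c)%R <= (c `^ Q)%:E * modular D q h'.
Proof.
move=> mh' h'0 c1 qQ; have c0 : (0 < c)%R by exact: lt_le_trans c1.
rewrite -ge0_integralZl_EFin//; last 3 first.
- by move=> x _; rewrite lee_fin powR_ge0.
- exact: measurable_modular_integrand.
- exact: powR_ge0.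
apply: ge0_le_integral_nm => x Dx; first by rewrite lee_fin powR_ge0.
rewrite -EFinM lee_fin powRM ?h'0 ?(ltW c0)// mulrC ler_wpM2r ?powR_ge0//.
by rewrite ler_powR.
Qed.

(** The infimum is attained when it is positive: a modular above 1 at [N] would exceed s^Q for some
    s > 1, whereas it is at most 1 at [N * s], and undoing this dilation costs at most the factor
    s^Q. *)
Lemma modular_gauge (N Q : R) : (forall x, q x <= Q)%R -> (0 < N)%R ->
  gauge D q h = N%:E -> modular D q (fun x => h x / N)%R <= 1.
Proof.
move=> qQ N0 gN; have [//|m1] := leP (modular D q (fun x => h x / N)%R) 1.
have Q0 : (0 < Q)%R by exact: lt_le_trans (qQ point).
have [s [s1 sm]] : exists s : R, (1 < s)%R /\
    (s `^ Q)%:E < modular D q (fun x => h x / N)%R.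
  have [r [r1 rm]] : exists r : R, (1 < r)%R /\
      r%:E < modular D q (fun x => h x / N)%R.
    case: (modular _ _ _) m1 => [m||]//.
      rewrite lte_fin => m1; exists ((1 + m) / 2)%R.
      by rewrite lte_fin; split; lra.
    by move=> _; exists 2%R; rewrite ltry; split => //; lra.
  have r0 : (0 < r)%R by exact: lt_trans r1.
  exists (r `^ Q^-1)%R; split.
    have := @gt0_ltr_powR R Q^-1 _ 1%R r; rewrite powR1.
    by apply; rewrite ?invr_gt0 ?nnegrE// ltW.
  by rewrite -powRrM mulVf ?gt_eqF// powRr1 ?ltW.
have s0 : (0 < s)%R by exact: lt_trans s1.
have : modular D q (fun x => h x / N)%R <= (s `^ Q)%:E.
  have -> : (fun x => h x / N)%R = (fun x => h x / (N * s) * s)%R.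
    by apply/funext => x; field; rewrite ?gt_eqF.
  have Ns : (0 < N * s)%R by rewrite mulr_gt0.
  apply: le_trans (modularZ_le_pow _ _ (ltW s1) qQ) _.
  - by apply: measurable_funM.
  - by move=> x Dx; rewrite divr_ge0 ?h0// (ltW Ns).
  rewrite -[leRHS]mule1 lee_wpmul2l ?lee_fin ?powR_ge0// modular_gauge_lt//.
  - by move=> x Dx; exact: ltW.
  - by rewrite gN lte_fin ltr_pMr.
by rewrite leNgt sm.
Qed.

End measurable_modular.
End modular.

Section conjugate_modular.
Context d (T : measurableType d) (R : realType).
Variable mu : {measure set T -> \bar R}.
Implicit Types (q h : T -> R) (D E : set T).

(** If the gauge were 0, admissible [l] could be taken arbitrarily small, and the modular of [h]
    itself, being at most [l], would vanish. Then [h] would be 0 almost everywhere on [D]. *)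
Lemma gauge_gt0 D q h : measurable D -> 0 < mu D ->
  measurable_fun setT q -> measurable_fun setT h -> (forall x, 1 <= q x)%R ->
  (forall x, D x -> 0 < h x)%R -> 0 < gauge mu D q h.
Proof.
move=> mD D0 mq mh q1 h0; rewrite lt_neqAle gauge_ge0 andbT eq_sym.
apply/eqP => g0.
have h0' x : D x -> (0 <= h x)%R by move=> Dx; exact/ltW/h0.
have m0 : modular mu D q h = 0.
  apply/eqP; rewrite eq_le modular_ge0 andbT; apply/lee_addgt0Pr => e e0.
  (* The minimum with 1 forces [l < 1], so that [modularZ_ge] applies to the factor [l^-1]. *)
  have em : (0 < Num.min e 1)%R by rewrite lt_min e0 ltr01.
  have /ereal_inf_lt[_ [l [l0 hl] <-]] : gauge mu D q h < (Num.min e 1)%:E.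
    by rewrite g0 lte_fin.
  rewrite lte_fin lt_min => /andP[le l1]; rewrite add0e.
  have l1' : (1 <= l^-1)%R by rewrite invr_ge1 ?unitfE ?gt_eqF// ltW.
  have := le_trans (modularZ_ge mu mD mq mh q1 h0' l1') hl.
  rewrite muleC -lee_pdivlMr ?invr_gt0// mul1e => H; apply: le_trans H _.
  by rewrite invrK lee_fin ltW.
have : ae_eq mu D (fun x => (h x `^ q x)%:E) (cst 0).
  apply/ae_eq_integral_abs => //; first exact: measurable_modular_integrand.
  rewrite -m0; apply: eq_integral => x _; rewrite gee0_abs// lee_fin.
  exact: powR_ge0.
move=> [N [mN N0 HN]].
have : mu D <= mu N.
  apply: le_measure; rewrite ?inE// => x Dx; apply: HN => /= /(_ Dx) [].
  by apply/eqP; rewrite gt_eqF// powR_gt0 ?h0.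
by rewrite N0 leNgt D0.
Qed.

(** * Young's inequality and the gauges of conjugate exponents *)

Section conjugate_pair.
Variables (q1 q2 : T -> R).
Hypotheses (mq1 : measurable_fun setT q1) (mq2 : measurable_fun setT q2).
Hypotheses (q1_ge1 : forall x, (1 <= q1 x)%R) (q2_ge1 : forall x, (1 <= q2 x)%R).
Hypothesis q12 : forall x, ((q1 x)^-1 + (q2 x)^-1 = 1)%R.

(** Pointwise Young inequality for [f1 / a] and [f2 / b], whose coefficients [1 / q1] and [1 / q2]
    are at most 1. It takes the place of Hoelder's inequality, keeping the two modulars separate. *)
Lemma young_integral D (f1 f2 : T -> R) (a b : R) : measurable D ->
  measurable_fun setT f1 -> measurable_fun setT f2 ->
  (forall x, D x -> 0 <= f1 x)%R -> (forall x, D x -> 0 <= f2 x)%R ->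
  (0 < a)%R -> (0 < b)%R ->
  \int[mu]_(x in D) (f1 x * f2 x)%:E <= (a * b)%:E *
    (modular mu D q1 (fun x => f1 x / a) + modular mu D q2 (fun x => f2 x / b))%R.
Proof.
move=> mD mf1 mf2 f10 f20 a0 b0.
have mm q f (c : R) : (forall x, 1 <= q x)%R -> measurable_fun setT q ->
    measurable_fun setT (f : T -> R) ->
    measurable_fun D (fun x => ((f x / c) `^ q x)%:E).
  by move=> q1' mq mf; apply: measurable_modular_integrand => //; exact: measurable_funM.
rewrite /modular -ge0_integralD//; try exact: mm; last 2 first.
- by move=> x _; rewrite lee_fin powR_ge0.
- by move=> x _; rewrite lee_fin powR_ge0.
rewrite -ge0_integralZl_EFin//; last 3 first.
- by move=> x _; rewrite -EFinD lee_fin addr_ge0 ?powR_ge0.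
- by apply: emeasurable_funD; exact: mm.
- by rewrite mulr_ge0// ltW.
apply: ge0_le_integral_nm => x Dx.
  by rewrite lee_fin mulr_ge0 ?f10 ?f20.
rewrite -EFinD -EFinM lee_fin.
have -> : (f1 x * f2 x = a * b * (f1 x / a * (f2 x / b)))%R.
  by field; rewrite ?gt_eqF.
rewrite ler_wpM2l// ?mulr_ge0 ?(ltW a0) ?(ltW b0)//.
have p1 : (0 < q1 x)%R by exact: lt_le_trans (q1_ge1 x).
have p2 : (0 < q2 x)%R by exact: lt_le_trans (q2_ge1 x).
have fa : (0 <= f1 x / a)%R by rewrite divr_ge0 ?f10// ltW.
have fb : (0 <= f2 x / b)%R by rewrite divr_ge0 ?f20// ltW.
apply: le_trans (conjugate_powR fa fb p1 p2 (q12 x)) _.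
by rewrite lerD// ler_pdivrMr// ler_peMr ?powR_ge0.
Qed.

(** Here (c/2)^(Q+1) is the share of the modular that the removed set is shown to carry in
    [gauge_setD_le]; the root of order [Q] converts what remains of the modular into a factor for
    the gauge. *)
Definition doubling_ratio (Q c : R) : R :=
  ((1 - (c / 2) `^ (Q + 1)) `^ Q^-1)%R.

Lemma doubling_ratio_itv (Q c : R) : (1 <= Q)%R -> (0 < c <= 1)%R ->
  (0 < doubling_ratio Q c < 1)%R.
Proof.
move=> Q1 /andP[c0 c1]; have Q0 : (0 < Q)%R by exact: lt_le_trans Q1.
have e1 : ((c / 2) `^ (Q + 1) < 1)%R.
  have := @gt0_ltr_powR R (Q + 1)%R _ (c / 2)%R 1%R; rewrite powR1.
  by apply; rewrite ?nnegrE; lra.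
have e0 : (0 < (c / 2) `^ (Q + 1))%R by rewrite powR_gt0; lra.
rewrite powR_gt0 ?subr_gt0//=.
have := @gt0_ltr_powR R (Q^-1)%R _ (1 - (c / 2) `^ (Q + 1))%R 1%R; rewrite powR1.
by apply; rewrite ?nnegrE ?invr_gt0//; lra.
Qed.

(* The weight keeps a fixed proportion of its modular on [E], by Young's
   inequality applied to [v1 * v2 = 1]; removing [E] therefore shrinks the gauge
   by a fixed factor. *)
Lemma gauge_setD_le D E (v1 v2 : T -> R) (U V Q c : R) :
  measurable D -> measurable E -> E `<=` D ->
  measurable_fun setT v1 -> measurable_fun setT v2 ->
  (forall x, 0 < v1 x)%R -> (forall x, 0 < v2 x)%R ->
  (forall x, v1 x * v2 x = 1)%R -> (forall x, q2 x <= Q)%R ->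
  (0 < U)%R -> (0 < V)%R -> (0 < c <= 1)%R ->
  modular mu D q1 (fun x => v1 x / V)%R <= 1 ->
  modular mu D q2 (fun x => v2 x / U)%R <= 1 ->
  (c * (V * U))%:E <= mu E ->
  gauge mu (D `\` E) q2 v2 <= (doubling_ratio Q c * U)%:E.
Proof.
move=> mD mE ED mv1 mv2 v10 v20 v12 qQ U0 V0 /andP[c0 c1] mV mU cE.
have Q1 : (1 <= Q)%R by exact: le_trans (q2_ge1 point) (qQ point).
have Q0 : (0 < Q)%R by exact: lt_le_trans Q1.
have [t0 t1] := andP (doubling_ratio_itv Q1 (introT andP (conj c0 c1))).
set e := (c / 2)%R; have e0 : (0 < e)%R by rewrite /e; lra.
have e1 : (e <= 1)%R by rewrite /e; lra.
have subE q h : measurable_fun setT q -> measurable_fun setT h ->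
    (forall x, 1 <= q x)%R -> modular mu E q h <= modular mu D q h.
  move=> mq mh q'1; apply: ge0_subset_integral => //.
    exact: measurable_modular_integrand.
  by move=> x _; rewrite lee_fin powR_ge0.
have mv1V : measurable_fun setT (fun x => v1 x / V)%R by exact: measurable_funM.
have mv2U : measurable_fun setT (fun x => v2 x / U)%R by exact: measurable_funM.
have mDE : modular mu D q2 (fun x => v2 x / U)%R =
    modular mu E q2 (fun x => v2 x / U)%R +
    modular mu (D `\` E) q2 (fun x => v2 x / U)%R.
  rewrite /modular -[in LHS](setDUK ED) ge0_integral_setU//.
  - exact: measurableD.
  - rewrite setDUK//; exact: measurable_modular_integrand.
  - by move=> x _; rewrite lee_fin powR_ge0.
  - by rewrite disj_set2E setDIK.
(* Young's inequality with the scales [V / e] and [e * U] gives c <= m1 + m2, where m1 <= e = c/2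
   and m2 is at most e^(-Q) times the modular sought. Hence e <= e^(-Q) m. *)
have lowE : (e `^ (Q + 1))%:E <= modular mu E q2 (fun x => v2 x / U)%R.
  have Y := @young_integral E v1 v2 (V / e) (e * U) mE mv1 mv2
    (fun x _ => ltW (v10 x)) (fun x _ => ltW (v20 x)) (divr_gt0 V0 e0)
    (mulr_gt0 e0 U0).
  move: Y; under eq_integral do rewrite v12.
  rewrite integral_cst// mul1e (_ : (V / e * (e * U) = V * U)%R); last first.
    by field; rewrite gt_eqF.
  move=> Y0; have {Y0} := le_trans cE Y0.
  rewrite mulrC EFinM lee_pmul2l ?lte_fin ?mulr_gt0// => Y.
  have Y1 : modular mu E q1 (fun x => v1 x / (V / e))%R <= e%:E.
    have -> : (fun x => v1 x / (V / e))%R = (fun x => (v1 x / V) * e)%R.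
      by apply/funext => x; field; rewrite !gt_eqF.
    apply: le_trans (modularZ_le mu mE mq1 mv1V q1_ge1 _ _) _.
    - by move=> x _; rewrite divr_ge0// ltW.
    - by rewrite e0.
    rewrite -[leRHS]mule1; apply: lee_wpmul2l; first by rewrite lee_fin ltW.
    exact: le_trans (subE _ _ mq1 mv1V q1_ge1) mV.
  have Y2 : modular mu E q2 (fun x => v2 x / (e * U))%R <=
      (e^-1 `^ Q)%:E * modular mu E q2 (fun x => v2 x / U)%R.
    have -> : (fun x => v2 x / (e * U))%R = (fun x => (v2 x / U) * e^-1)%R.
      by apply/funext => x; field; rewrite !gt_eqF.
    apply: modularZ_le_pow => //.
    - by move=> x _; rewrite divr_ge0// ltW.
    - by rewrite invr_ge1 ?unitfE ?gt_eqF.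
  have {Y Y1 Y2} := le_trans Y (leeD Y1 Y2).
  case: (modular mu E q2 _) => [m||]; last 2 first.
  - by rewrite leey.
  - by rewrite gt0_muleNy ?lte_fin ?powR_gt0 ?invr_gt0.
  rewrite -EFinM -EFinD !lee_fin => Y.
  have eQ : (0 < e `^ Q)%R by rewrite powR_gt0.
  have {}Y : (e <= e^-1 `^ Q * m)%R by rewrite /e in Y *; lra.
  rewrite powRD; last by rewrite (gt_eqF e0) implybT.
  rewrite powRr1 ?(ltW e0)// mulrC -ler_pdivlMr//.
  by rewrite -powR_inv1 ?(ltW e0)// -powRrM mulN1r powRN mulrC in Y.
apply: gauge_le; first by rewrite mulr_gt0.
have -> : (fun x => v2 x / (doubling_ratio Q c * U))%R =
    (fun x => v2 x / U * (doubling_ratio Q c)^-1)%R.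
  by apply/funext => x; field; rewrite !gt_eqF.
have t1' : (1 <= (doubling_ratio Q c)^-1)%R.
  by rewrite invr_ge1 ?unitfE ?gt_eqF// ltW.
have v2U0 x : (D `\` E) x -> (0 <= v2 x / U)%R by move=> _; rewrite divr_ge0// ltW.
apply: le_trans (modularZ_le_pow mu (measurableD mD mE) mq2 q2_ge1 mv2U v2U0 t1' qQ) _.
have {}mDE : modular mu (D `\` E) q2 (fun x => v2 x / U)%R <=
    (1 - e `^ (Q + 1))%:E.
  move: lowE mU; rewrite mDE; set m := modular mu E _ _.
  have : 0 <= m by exact: modular_ge0.
  have : 0 <= modular mu (D `\` E) q2 (fun x => v2 x / U)%R by exact: modular_ge0.
  case: (modular _ _ _ _) => [a||]//; case: m => [b||]//.
  by rewrite -EFinD !lee_fin; lra.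
have d0 : (0 <= 1 - e `^ (Q + 1))%R.
  by rewrite -lee_fin; apply: le_trans mDE; exact: modular_ge0.
apply: le_trans (lee_wpmul2l _ mDE) _; first by rewrite lee_fin powR_ge0.
have rQ : (doubling_ratio Q c `^ Q = 1 - e `^ (Q + 1))%R.
  by rewrite -powRrM mulVf ?gt_eqF// powRr1.
rewrite -EFinM lee_fin -powR_inv1 ?(ltW t0)// powRAC rQ powR_inv1// mulVf//.
by rewrite -rQ gt_eqF// powR_gt0.
Qed.

End conjugate_pair.

(* [M `^ (1 - t * q x)] is bounded because [M] lies between [2^-J] and [2] while
   [1 - t * q x] is [O(1 / J)]. *)
Lemma modular_rescale_le D q h (t Q L J M : R) : measurable D ->
  measurable_fun setT q -> measurable_fun setT h ->
  (forall x, 1 <= q x)%R -> (forall x, 0 <= h x)%R ->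
  (0 <= t <= 1)%R -> (0 <= J)%R -> (2 `^ (- J) <= M <= 2)%R ->
  (forall x, D x -> `|1 - t * q x| * J <= L)%R ->
  modular mu D q h <= M%:E ->
  modular mu D q (fun x => h x / M `^ t)%R <= (2 * 2 `^ L)%:E.
Proof.
move=> mD mq mh q1 h0 /andP[t0 t1] J0 /andP[JM M2] qt hM.
have M0 : (0 < M)%R by apply: lt_le_trans JM; rewrite powR_gt0.
have K0 : (0 <= 2 * 2 `^ L)%R by rewrite mulr_ge0 ?powR_ge0.
rewrite (@le_trans _ _ ((2 * 2 `^ L / M)%:E * modular mu D q h))//; last first.
  apply: le_trans (lee_wpmul2l _ hM) _; first by rewrite lee_fin divr_ge0// ltW.
  by rewrite -EFinM lee_fin divfK// gt_eqF.
rewrite -ge0_integralZl_EFin//; last 3 first.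
- by move=> x _; rewrite lee_fin powR_ge0.
- exact: measurable_modular_integrand.
- by rewrite divr_ge0// ltW.
apply: ge0_le_integral_nm => x Dx; first by rewrite lee_fin powR_ge0.
rewrite -EFinM lee_fin powRM ?invr_ge0 ?powR_ge0// mulrC.
rewrite ler_wpM2r ?powR_ge0//.
(* The factor [1 / M] is absorbed by the bound on the modular of [h]; only the power with the small
   exponent remains to be bounded. *)
have -> : ((M `^ t)^-1 `^ q x = M `^ (1 - t * q x) / M)%R.
  rewrite -powR_inv1 ?powR_ge0// -!powRrM mulN1r mulrN.
  rewrite powRD; last by rewrite (gt_eqF M0) implybT.
  by rewrite powRr1 ?(ltW M0)// mulrAC divff ?mul1r// gt_eqF.
rewrite ler_wpM2r ?invr_ge0 ?(ltW M0)//.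
have L0 : (0 <= L)%R by apply: le_trans (qt _ Dx); rewrite mulr_ge0.
have L1 : (1 <= 2 `^ L :> R)%R by rewrite -[leLHS](powRr0 2) ler_powR// ler1n.
have [M1|M1] := leP 1%R M.
  apply: (@le_trans _ _ M); last by apply: le_trans M2 _; rewrite ler_peMr.
  rewrite -[leRHS]powRr1 ?(ltW M0)// ler_powR// gerBl mulr_ge0//.
  exact: le_trans (q1 x).
apply: (@le_trans _ _ (2 `^ L)%R); last by rewrite ler_peMl ?powR_ge0// ler1n.
apply: (@le_trans _ _ (M `^ (- `|1 - t * q x|))%R).
  rewrite ger_powR ?M0 ?(ltW M1)//.
  by rewrite lerNl -normrN ler_norm.
apply: (@le_trans _ _ ((2 `^ (- J)) `^ (- `|1 - t * q x|))%R); last first.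
  by rewrite -powRrM mulNr mulrN opprK ler_powR ?ler1n// mulrC qt.
rewrite !powRN lef_pV2 ?posrE ?powR_gt0//.
by rewrite ge0_ler_powR// ?nnegrE ?invr_ge0 ?powR_ge0 ?(ltW M0)// -powRN.
Qed.

End conjugate_modular.

(** * Near-extremizers for the duality of gauges *)

Section extremizer.
Context d (T : measurableType d) (R : realType).
Variable mu : {sigma_finite_measure set T -> \bar R}.
Variables (q1 q2 : T -> R).
Hypotheses (mq1 : measurable_fun setT q1) (mq2 : measurable_fun setT q2).
Hypotheses (q1_ge1 : forall x, (1 <= q1 x)%R) (q2_ge1 : forall x, (1 <= q2 x)%R).
Hypothesis q12 : forall x, ((q1 x)^-1 + (q2 x)^-1 = 1)%R.

(** Exhaust [D] by sets of finite measure on which [h] is at most [k]. By monotone convergence the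
    modular exceeds 1 on one of them, and it is finite there, so that dividing by it makes sense in
    [gauge_extremizer]. *)
Lemma modular_truncation (D : set T) (h : T -> R) (Q : R) : measurable D ->
  measurable_fun setT h -> (forall x, 0 <= h x)%R -> (forall x, q2 x <= Q)%R ->
  1 < modular mu D q2 h ->
  exists E, [/\ measurable E, E `<=` D & 1 < modular mu E q2 h < +oo].
Proof.
move=> mD mh h0 qQ h1.
have /sigma_finiteP[F [TF ndF Foo]] := sigma_finiteT mu.
pose E k := D `&` (F k `&` [set x | h x <= k%:R]%R).
have mhk k : measurable [set x | h x <= k%:R]%R.
  rewrite -[X in measurable X]setTI.
  by apply: measurable_fun_ler => //.
have mE k : measurable (E k) by do 2 apply: measurableI => //; exact: (Foo k).1.
have ndE : nondecreasing_seq E.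
  move=> a b ab; apply/subsetPset => x [Dx [Fx hx]]; split => //; split.
    by have /subsetPset := ndF _ _ ab; exact.
  by rewrite /= (le_trans hx)// ler_nat.
have UE : \bigcup_k E k = D.
  apply/seteqP; split => [x [k _ []]//|x Dx].
  have [i _ Fx] : (\bigcup_i F i) x by rewrite -TF.
  exists (maxn i (Num.bound (h x))) => //; split => //; split.
    have /subsetPset := ndF _ _ (leq_maxl i (Num.bound (h x))); exact.
  rewrite /= (le_trans (ltW (archi_boundP (h0 x))))// ler_nat leq_maxr//.
have mm k : measurable_fun (E k) (fun x => (h x `^ q2 x)%:E).
  exact: measurable_modular_integrand.
have : modular mu (E k) q2 h @[k --> \oo] --> modular mu D q2 h.
  rewrite -UE; apply: ge0_nondecreasing_set_cvg_integral => //.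
  by move=> i x _; rewrite lee_fin powR_ge0.
move=> cv; have [k hk] : exists k, 1 < modular mu (E k) q2 h.
  apply/not_existsP => H; move: h1; rewrite ltNge => /negP; apply.
  rewrite -(cvg_lim _ cv)//; apply: lime_le; first by apply/cvg_ex; eexists; exact: cv.
  by apply: nearW => k; rewrite leNgt; apply/negP/H.
exists (E k); split => //; first by move=> x [].
rewrite hk /=.
(* A base at least 1 is required to raise the exponent from [q2 x] to [Q]. *)
have k0 : (1 <= Num.max 1 k%:R :> R)%R by rewrite le_max lexx.
apply: (@le_lt_trans _ _ (\int[mu]_(x in E k) (Num.max 1 k%:R `^ Q)%:E)).
  apply: ge0_le_integral_nm => x [_ [_ /= hx]]; rewrite lee_fin ?powR_ge0//.
  apply: (@le_trans _ _ (Num.max 1 k%:R `^ q2 x)%R).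
    rewrite ge0_ler_powR ?nnegrE ?h0//.
    - by rewrite (le_trans _ (q2_ge1 x)).
    - by rewrite le_max hx orbT.
  by rewrite ler_powR.
rewrite integral_cst// lte_mul_pinfty ?lee_fin ?powR_ge0//.
apply: le_lt_trans (Foo k).2; apply: le_measure; rewrite ?inE//.
  exact: (Foo k).1.
by move=> x [_ []].
Qed.

(** The equality case of Young's inequality suggests f = (v2/l)^q2 l/M on the set [E] of
    [modular_truncation], with M > 1 the modular of v2/l on [E]. Its integral is exactly [l]. Since
    q1 (q2 - 1) = q2, the function f v1 = (v2/l)^(q2-1)/M has modular at most M/M = 1. *)
Lemma gauge_extremizer (D : set T) (v1 v2 : T -> R) (l Q : R) : measurable D ->
  measurable_fun setT v1 -> measurable_fun setT v2 ->
  (forall x, 0 < v1 x)%R -> (forall x, 0 < v2 x)%R ->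
  (forall x, v1 x * v2 x = 1)%R -> (forall x, q2 x <= Q)%R ->
  (0 < l)%R -> l%:E < gauge mu D q2 v2 ->
  exists f : T -> R, [/\ measurable_fun setT f, forall x, (0 <= f x)%R,
    forall x, ~ D x -> f x = 0%R, gauge mu setT q1 (fun x => f x * v1 x)%R <= 1
    & l%:E <= \int[mu]_(x in D) (f x)%:E].
Proof.
move=> mD mv1 mv2 v10 v20 v12 qQ l0 lg.
have h0 x : (0 < v2 x / l)%R by rewrite divr_gt0.
have h0' x : (0 <= v2 x / l)%R by exact: ltW.
have mh : measurable_fun setT (fun x => v2 x / l)%R by exact: measurable_funM.
have h1 : 1 < modular mu D q2 (fun x => v2 x / l)%R.
  by rewrite ltNge; apply: contraTN lg => /(gauge_le l0); rewrite -leNgt.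
have [E [mE ED /andP[M1 Moo]]] := modular_truncation mD mh h0' qQ h1.
have [M EM] : exists M : R, modular mu E q2 (fun x => v2 x / l)%R = M%:E.
  exists (fine (modular mu E q2 (fun x => v2 x / l)%R)).
  by rewrite fineK// gt0_fin_numE// (lt_trans _ M1).
rewrite EM lte_fin in M1 => {Moo}; have M0 : (0 < M)%R by exact: lt_trans M1.
have p1 x : (0 < q1 x)%R by exact: lt_le_trans (q1_ge1 x).
have p2 x : (0 < q2 x)%R by exact: lt_le_trans (q2_ge1 x).
have p21 x : (0 < q2 x - 1)%R.
  rewrite subr_gt0 -invf_lt1// -(q12 x) ltrDr invr_gt0//.
pose f x := ((v2 x / l) `^ (q2 x) / M * l * \1_E x)%R.
have mf : measurable_fun setT f.
  apply: measurable_funM; last exact: measurable_indic.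
  by do 2 apply: measurable_funM => //; exact: measurable_powR_var.
have f0 x : (0 <= f x)%R.
  by rewrite !mulr_ge0 ?powR_ge0 ?invr_ge0 ?(ltW M0) ?(ltW l0).
exists f; split => //.
- by move=> x Dx; rewrite /f indicE memNset ?mulr0// => /ED.
- apply: gauge_le => //.
  have -> : modular mu setT q1 (fun x => f x * v1 x / 1)%R =
      modular mu E q1 (fun x => (v2 x / l) `^ (q2 x - 1) * M^-1)%R.
    rewrite /modular [RHS]integral_mkcond; apply: eq_integral => x _.
    rewrite patchE /f indicE; case: ifPn => xE; last first.
      by rewrite mulr0 !mul0r powR0// gt_eqF.
    congr (_ `^ _)%:E; rewrite mulr1 divr1.
    rewrite -(mulr_powRB1 (h0' x) (p2 x)).
    rewrite -[RHS]mul1r -(v12 x); field; rewrite ?gt_eqF//.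
  have iM1 : (0 < M^-1 <= 1)%R by rewrite invr_gt0 M0 invf_le1// ltW.
  apply: le_trans (modularZ_le mu mE mq1 _ q1_ge1 _ iM1) _.
  + by apply: measurable_powR_var => //; exact: measurable_funB.
  + by move=> x _; rewrite powR_ge0.
  have -> : modular mu E q1 (fun x => (v2 x / l) `^ (q2 x - 1))%R = M%:E.
    rewrite -EM; apply: eq_integral => x _; congr (_%:E).
    rewrite -powRrM; congr powR; have := q12 x.
    move/(congr1 (fun z => z * (q1 x * q2 x))%R).
    rewrite mulrDl mul1r mulrA mulVf ?gt_eqF// mul1r mulrCA mulVf ?gt_eqF//.
    by lra.
  by rewrite -EFinM mulVf ?gt_eqF.
- apply: (@le_trans _ _ (\int[mu]_(x in E) (f x)%:E)); last first.
    apply: ge0_subset_integral => //.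
      by apply: measurable_funTS; exact/measurable_EFinP.
    by move=> x _; rewrite lee_fin.
  rewrite (@eq_integral _ _ _ _ _ (fun x => (l / M)%:E * ((v2 x / l) `^ q2 x)%:E)); last first.
    by move=> x xE; rewrite /f indicE xE mulr1 -EFinM; congr (_%:E); lra.
  rewrite ge0_integralZl_EFin//; last 3 first.
  + by move=> x _; rewrite lee_fin powR_ge0.
  + exact: measurable_modular_integrand.
  + by rewrite divr_ge0// ltW.
  by rewrite -/(modular mu E q2 _) EM -EFinM divfK// gt_eqF.
Qed.

End extremizer.

(** * Lebesgue measure of dyadic annuli *)

Section euclidean.
Context (R : realType).

Lemma measurable_Rn n (A : set (Rn R n)) :
  @measurable _ (n.-tuple (measurableTypeR R)) A -> measurable A.
Proof.
by move=> mA; apply: sub_caratheodory; apply: sub_sigma_algebra.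
Qed.

Lemma lebesgueE n (A : set (Rn R n)) :
  @measurable _ (n.-tuple (measurableTypeR R)) A ->
  lebesgue R n A = lebesgue_borel R n A.
Proof. exact: measurable_mu_extE. Qed.

Lemma measurable_pcoord n (i : 'I_n) :
  measurable_fun [set: Rn R n] (@pcoord R n i : Rn R n -> measurableTypeR R).
Proof.
move=> _ Y mY; rewrite setTI; apply: measurable_Rn.
by rewrite -[X in measurable X]setTI; apply: measurable_tnth.
Qed.

Lemma measurable_enorm n : measurable_fun [set: Rn R n] (@enorm R n).
Proof.
apply: (@measurableT_comp _ _ _ _ _ _ (@Num.sqrt R)).
  by apply: continuous_measurable_fun; exact: sqrt_continuous.
apply: measurable_sum => i; apply: measurable_funX.
exact: measurable_pcoord.
Qed.

Lemma enorm_ge0 n (x : Rn R n) : (0 <= enorm x)%R.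
Proof. exact: sqrtr_ge0. Qed.

Definition cube n (I : set R) : set (Rn R n) :=
  [set x | forall i, I (pcoord i x)].

Lemma measurable_cube n (I : set R) : measurable (I : set (measurableTypeR R)) ->
  @measurable _ (n.-tuple (measurableTypeR R)) (@cube n I).
Proof.
move=> mI; have -> : @cube n I = \bigcap_(i in [set: 'I_n]) (@pcoord R n i) @^-1` I.
  by apply/seteqP; split => [x Ix i _|x Ix i]; [exact: Ix|exact: Ix].
apply: fin_bigcap_measurable; first exact: finite_finset.
move=> i _; rewrite -[X in measurable X]setTI; exact: measurable_tnth.
Qed.

Lemma lebesgue_borel_cube n (I : set R) : measurable (I : set (measurableTypeR R)) ->
  lebesgue_borel R n (cube I) = (@lebesgue_measure R I) ^+ n.
Proof.
move=> mI; elim: n => [|n IH].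
  by rewrite expe0 /= diracE mem_set// => -[].
rewrite expeS -IH /= /lebesgue_cons /pushforward.
have -> : tcons @^-1` (@cube n.+1 I) = I `*` (@cube n I).
  apply/seteqP; split => [[x t]/= H|[x t]/= [Ix It] i].
    split => [|i]; first exact: (H ord0).
    by have := H (lift ord0 i); rewrite /pcoord tnthS.
  case: (unliftP ord0 i) => [j|] ->; rewrite /pcoord ?tnth0 ?tnthS//; exact: It.
by rewrite product_measure1E//; exact: measurable_cube.
Qed.

Lemma lebesgue_cube n (I : set R) : measurable (I : set (measurableTypeR R)) ->
  lebesgue R n (cube I) = (@lebesgue_measure R I) ^+ n.
Proof.
move=> mI; rewrite -(lebesgue_borel_cube n mI); apply: lebesgueE.
exact: measurable_cube.
Qed.

Lemma enorm_eq0 n (x : Rn R n) : enorm x = 0%R -> forall i, pcoord i x = 0%R.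
Proof.
move=> /eqP; rewrite /enorm sqrtr_eq0 => S0 i.
apply/eqP; rewrite -sqrf_eq0 eq_le sqr_ge0 andbT; apply: le_trans S0.
by rewrite (bigD1 i)//= lerDl sumr_ge0// => k _; exact: sqr_ge0.
Qed.

(** The origin lies in the n-th power of a null set of the line. In dimension 0 it would be the
    whole space, of mass 1. *)
Lemma lebesgue_origin n : (0 < n)%N ->
  lebesgue R n [set x | enorm x = 0%R] = 0.
Proof.
move=> n0; apply/eqP; rewrite -measure_le0.
have m1 : measurable ([set 0%R] : set (measurableTypeR R)) by exact: measurable_set1.
have -> : 0 = @lebesgue_measure R [set 0%R] ^+ n.
  by apply/esym/eqP; rewrite expe_eq0 n0 lebesgue_measure_set1/=.
rewrite -lebesgue_cube//.
apply: le_measure; rewrite ?inE.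
- rewrite -[X in measurable X]setTI.
  exact: (@measurable_enorm n measurableT [set 0%R] (measurable_set1 0%R)).
- by apply: measurable_Rn; exact: measurable_cube.
- by move=> x /= /enorm_eq0.
Qed.

Definition dyadic (j : int) : R := (2 `^ j%:~R)%R.

Definition annulus n (j : int) : set (Rn R n) :=
  [set x | (dyadic j <= enorm x < dyadic (j + 1))%R].

Lemma dyadic_gt0 j : (0 < dyadic j)%R.
Proof. by rewrite powR_gt0. Qed.

Lemma dyadicS j : dyadic (j + 1) = (2 * dyadic j)%R.
Proof.
rewrite /dyadic intrD powRD ?pnatr_eq0 ?implybT//.
by rewrite powRr1 ?ler0n// mulrC.
Qed.

Lemma le_dyadic (j k : int) : (j <= k)%R -> (dyadic j <= dyadic k)%R.
Proof. by move=> jk; rewrite ler_powR ?ler1n// ler_int. Qed.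

Lemma dyadic_lt (j k : int) : (dyadic j < dyadic k)%R -> (j < k)%R.
Proof. by move=> jk; rewrite ltNge; apply: contraTN jk => /le_dyadic; rewrite leNgt. Qed.

Lemma measurable_eball0 n b : measurable (@eball0 R n b).
Proof.
rewrite -[X in measurable X]setTI.
by apply: measurable_fun_ltr => //; exact: measurable_enorm.
Qed.

Lemma annulusE n j :
  @annulus n j = eball0 (dyadic (j + 1)) `\` eball0 (dyadic j).
Proof.
apply/seteqP; split => x /=.
  by move=> /andP[a b]; split => //; apply/negP; rewrite -leNgt.
by move=> [b /negP]; rewrite -leNgt => a; apply/andP.
Qed.

Lemma measurable_annulus n j : measurable (@annulus n j).
Proof. by rewrite annulusE; apply: measurableD; exact: measurable_eball0. Qed.

Lemma annulus_inj n (x : Rn R n) (j k : int) :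
  annulus j x -> annulus k x -> j = k.
Proof.
move=> /andP[jx xj] /andP[kx xk]; apply/eqP; rewrite eq_le.
by rewrite -!ltzD1 (dyadic_lt (le_lt_trans jx xk)) (dyadic_lt (le_lt_trans kx xj)).
Qed.

Lemma annulus_cover n (x : Rn R n) : (0 < enorm x)%R ->
  exists j, annulus j x.
Proof.
move=> x0; pose j := Num.floor (ln (enorm x) / ln 2).
have l2 : (0 < ln 2 :> R)%R by rewrite ln_gt0// ltr1n.
exists j; rewrite /annulus /= /dyadic /powR pnatr_eq0/=.
rewrite -{1 2}[enorm x]lnK ?posrE// ler_expR ltr_expR.
rewrite -ler_pdivlMr// -ltr_pdivrMr//.
exact: floor_itv.
Qed.

Lemma enorm_cube n (a : R) (x : Rn R n) : (0 < n)%N -> (0 < a)%R ->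
  cube `[a, (2 * a)%R[ x ->
  (Num.sqrt n%:R * a <= enorm x < 2 * (Num.sqrt n%:R * a))%R.
Proof.
move=> n0 a0 cx.
have sa c : (0 <= c)%R -> (Num.sqrt n%:R * c = Num.sqrt (\sum_(i < n) c ^+ 2) :> R)%R.
  move=> c0; rewrite sumr_const card_ord -[(c ^+ 2 *+ n)%R]mulr_natl sqrtrM ?ler0n//.
  by rewrite sqrtr_sqr ger0_norm.
rewrite mulrCA !sa ?(ltW a0) ?mulr_ge0 ?(ltW a0)// /enorm.
have cx' i : (a <= pcoord i x < 2 * a)%R by have := cx i; rewrite /= in_itv.
have c0 i : (0 <= pcoord i x)%R by have /andP[h _] := cx' i; apply: le_trans h; exact: ltW.
rewrite ler_sqrt ?ltr_sqrt; last 2 first.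
- by rewrite sumr_const card_ord pmulrn_lgt0// exprn_gt0// mulr_gt0.
- by apply: sumr_ge0 => i _; exact: sqr_ge0.
apply/andP; split.
  apply: ler_sum => i _; have /andP[h _] := cx' i.
  by rewrite ler_sqr ?nnegrE// ltW.
(* One coordinate is split off to carry the strict inequality; the others are compared weakly. *)
rewrite (bigD1 (Ordinal n0))//= [ltRHS](bigD1 (Ordinal n0))//=.
have ltx i : (pcoord i x ^+ 2 < (2 * a) ^+ 2)%R.
  by have /andP[_ h] := cx' i; rewrite ltr_sqr ?nnegrE// mulr_ge0// ltW.
by rewrite ltr_leD// ler_sum// => i _; exact/ltW/ltx.
Qed.

(** With a = 2^j / sqrt n, the cube [a, 2a[^n is contained in the annulus, because the vector with
    all coordinates equal to a has norm a sqrt n = 2^j. *)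
Lemma lebesgue_annulus_ge n j : (0 < n)%N ->
  ((dyadic j / Num.sqrt n%:R) ^+ n)%:E <= lebesgue R n (annulus j).
Proof.
move=> n0; have s0 : (0 < Num.sqrt n%:R :> R)%R by rewrite sqrtr_gt0 ltr0n.
set a := (dyadic j / Num.sqrt n%:R)%R.
have a0 : (0 < a)%R by rewrite divr_gt0// dyadic_gt0.
have mI : measurable (`[a, (2 * a)%R[ : set (measurableTypeR R)).
  exact: measurable_itv.
have -> : (a ^+ n)%:E = lebesgue R n (cube `[a, (2 * a)%R[).
  rewrite lebesgue_cube// lebesgue_measure_itv/= lte_fin ltr_pMl// ltr1n.
  by rewrite -EFinB -EFin_expe; congr (_ ^+ _)%:E; lra.
apply: le_measure; rewrite ?inE.
- by apply: measurable_Rn; exact: measurable_cube.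
- exact: measurable_annulus.
move=> x /(enorm_cube n0 a0); rewrite /annulus /= dyadicS.
by rewrite /a mulrCA mulfV ?mulr1// gt_eqF.
Qed.

End euclidean.

(** * Series indexed by dyadic scales *)

Section dyadic_series.
Context (R : realType).

(** Series and countable partitions are indexed by [nat], whereas annuli are indexed by [int]. Odd
    codes give the negative integers, [Negz m] being -(m+1). *)
Definition zenum (i : nat) : int := if odd i then Negz i./2 else Posz i./2.

Lemma zenum_bij : set_bij [set: nat] [set: int] zenum.
Proof.
split => //.
- move=> i j _ _; rewrite /zenum.
  case: ifPn => oi; case: ifPn => oj // -[ij].
    by rewrite -(odd_double_half i) -(odd_double_half j) oi oj ij.
  by rewrite -(odd_double_half i) -(odd_double_half j) (negbTE oi) (negbTE oj) ij.
- move=> [m|m] _ /=.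
    by exists m.*2 => //; rewrite /zenum odd_double doubleK.
  by exists m.*2.+1 => //; rewrite /zenum /= odd_double /= uphalf_double.
Qed.

Lemma nneseries_zenum (F : int -> \bar R) : (forall z, 0 <= F z) ->
  \sum_(i <oo) F (zenum i) = \esum_(z in [set: int]) F z.
Proof.
move=> F0; rewrite nneseries_esumT//.
by rewrite (reindex_esum [set: nat] [set: int] zenum)//; exact: zenum_bij.
Qed.

Lemma nneseries_le (F : nat -> R) (S : R) : (forall i, 0 <= F i)%R ->
  (forall N, \sum_(0 <= i < N) F i <= S)%R -> \sum_(i <oo) (F i)%:E <= S%:E.
Proof.
move=> F0 FS; apply: lime_le.
  by apply: is_cvg_nneseries => i _ _; rewrite lee_fin.
by apply: nearW => N; rewrite sumEFin lee_fin.
Qed.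

(** A sum of non-negative terms over all integers is invariant under translation, which removes [k].
    As |zenum i| >= i./2, the rest is bounded by a geometric series with every term taken twice. *)
Lemma dyadic_series (t : R) (k : int) : (0 < t < 1)%R ->
  \sum_(i <oo) (t ^+ `|zenum i - k|%N)%:E <= (2 / (1 - t))%:E.
Proof.
move=> /andP[t0 t1].
have p0 z : 0 <= (t ^+ `|z|%N)%:E by rewrite lee_fin exprn_ge0// ltW.
rewrite (@nneseries_zenum (fun z => (t ^+ `|z - k|%N)%:E))//.
have -> : \esum_(z in [set: int]) (t ^+ `|z - k|%N)%:E =
    \esum_(z in [set: int]) (t ^+ `|z|%N)%:E.
  rewrite [RHS](reindex_esum [set: int] [set: int] (fun z => z - k)%R)//.
  split => //; first by move=> a b _ _ /addIr.
  by move=> z _; exists (z + k)%R; rewrite ?addrK.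
rewrite -(@nneseries_zenum (fun z => (t ^+ `|z|%N)%:E))//.
apply: (@le_trans _ _ (\sum_(i <oo) (t ^+ i./2)%:E)).
  apply: lee_nneseries => // i _; rewrite lee_fin ler_wiXn2l ?ltW// /zenum.
  by case: ifPn => // _; rewrite /= leqW.
have h0 i : (0 <= t ^+ i)%R by rewrite exprn_ge0// ltW.
apply: nneseries_le => // N.
(* An even number of terms lets equal powers pair up, giving a closed form. *)
apply: (@le_trans _ _ (\sum_(0 <= i < N.*2) t ^+ i./2)%R).
  rewrite [leRHS](@big_cat_nat _ _ _ N)//=; last by rewrite -addnn leq_addr.
  by rewrite lerDl sumr_ge0.
have -> : (\sum_(0 <= i < N.*2) t ^+ i./2 = 2 * (1 - t ^+ N) / (1 - t))%R.
  elim: N => [|N IH]; first by rewrite big_geq// expr0 subrr mulr0 mul0r.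
  rewrite doubleS !big_nat_recr//= IH uphalf_double doubleK exprS.
  by field; rewrite subr_eq0 gt_eqF.
by rewrite ler_pM2r ?invr_gt0 ?subr_gt0// ler_piMr// gerBl.
Qed.

(** As in Schur's test, [w] is summed first, over [k] for the terms in [M i] and over [i] for those
    in [M' k]; the last term is a product of two single series. In the application [w] is r^|j-k|
    and [u] is r^|j|. *)
Lemma double_series_le (M M' u : nat -> R) (w : nat -> nat -> R) (S0 S : R) :
  (forall i, 0 <= M i)%R -> (forall i, 0 <= M' i)%R -> (forall i, 0 <= u i)%R ->
  (forall i k, 0 <= w i k)%R -> (forall i k, w i k = w k i) ->
  \sum_(i <oo) (M i)%:E <= S0%:E -> \sum_(i <oo) (M' i)%:E <= S0%:E ->
  \sum_(i <oo) (u i)%:E <= S%:E ->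
  (forall k, \sum_(i <oo) (w i k)%:E <= S%:E) ->
  \sum_(k <oo) \sum_(i <oo) ((M i + M' k) * w i k + 4 * (u i * u k))%:E
    <= (S0 * S + S0 * S + 4 * (S * S))%:E.
Proof.
move=> M0 M'0 u0 w0 wC MS M'S uS wS.
have S_ge0 : 0 <= S%:E.
  by apply: le_trans uS; apply: nneseries_ge0 => i _ _; rewrite lee_fin.
have sc (a : nat -> R) (b : nat -> nat -> R) A : (forall i, 0 <= a i)%R ->
    (forall i k, 0 <= b i k)%R -> \sum_(k <oo) (a k)%:E <= A%:E ->
    (forall k, \sum_(i <oo) (b i k)%:E <= S%:E) ->
    \sum_(k <oo) \sum_(i <oo) (a k * b i k)%:E <= (A * S)%:E.
  move=> a0 b0 aA bS.
  apply: (@le_trans _ _ (\sum_(k <oo) (S%:E * (a k)%:E))).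
    apply: lee_nneseries => [k _ _|k _].
      by apply: nneseries_ge0 => i _ _; rewrite lee_fin mulr_ge0.
    under eq_eseriesr do rewrite EFinM.
    rewrite nneseriesZl; last by move=> i _; rewrite lee_fin.
    by rewrite muleC lee_wpmul2r ?lee_fin.
  rewrite nneseriesZl; last by move=> i _; rewrite lee_fin.
  by rewrite mulrC EFinM lee_wpmul2l.
have p1 k i : 0 <= (M i * w i k)%:E by rewrite lee_fin mulr_ge0.
have p2 k i : 0 <= (M' k * w i k)%:E by rewrite lee_fin mulr_ge0.
have p3 k i : 0 <= (4 * u k * u i)%:E by rewrite lee_fin !mulr_ge0.
rewrite (@eq_eseriesr _ _ (fun k => \sum_(i <oo) (M i * w i k)%:E +
  \sum_(i <oo) (M' k * w i k)%:E + \sum_(i <oo) (4 * u k * u i)%:E)); last first.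
  move=> k _; rewrite -!nneseriesD// => [|i _ _]; last by rewrite adde_ge0.
  by apply: eq_eseriesr => i _; rewrite -!EFinD; congr (_%:E); lra.
rewrite !nneseriesD; try by move=> *; rewrite ?adde_ge0// nneseries_ge0.
rewrite 2!EFinD; apply: leeD; first apply: leeD.
(* After the interchange, symmetry of [w] brings the term back to the pattern [sc]. *)
- rewrite nneseries_interchange//; under eq_eseriesr do under eq_eseriesr do rewrite wC.
  exact: (sc M w).
- exact: sc.
- rewrite mulrA; apply: (sc (fun k => 4 * u k)%R (fun i _ => u i)) => //.
    by move=> i; rewrite mulr_ge0.
  under eq_eseriesr do rewrite EFinM.
  rewrite nneseriesZl; last by move=> i _; rewrite lee_fin.
  by rewrite EFinM lee_wpmul2l// lee_fin.
Qed.

End dyadic_series.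

(** On a product of two pieces the integrand is at most a constant times [f x * g y], so the double
    integral factors there. The inner integral is bounded by the measurable function [g y * W]
    before the outer one is split. *)
Lemma double_integral_le_series d (T : measurableType d) (R : realType)
    (mu : {measure set T -> \bar R}) (A : (set T)^nat) (h : T -> T -> R)
    (f g : T -> R) (c : nat -> nat -> R) (phi psi : nat -> R) :
  (forall k, measurable (A k)) -> trivIset setT A ->
  mu (~` \bigcup_k A k) = 0 ->
  measurable_fun setT f -> measurable_fun setT g ->
  (forall x, 0 <= f x)%R -> (forall x, 0 <= g x)%R ->
  (forall i k, 0 <= c i k)%R -> (forall x y, 0 <= h x y)%R ->
  (forall i k x y, A i x -> A k y -> h x y <= c i k * f x * g y)%R ->
  (forall i, \int[mu]_(x in A i) (f x)%:E <= (phi i)%:E) ->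
  (forall k, \int[mu]_(x in A k) (g x)%:E <= (psi k)%:E) ->
  \int[mu]_y \int[mu]_x (h x y)%:E <=
    \sum_(k <oo) \sum_(i <oo) (c i k * phi i * psi k)%:E.
Proof.
move=> mA tA A0 mf mg f0 g0 c0 h0 hc fphi gpsi.
have If0 i : 0 <= \int[mu]_(x in A i) (f x)%:E.
  by apply: integral_ge0 => x _; rewrite lee_fin.
have phi0 i : (0 <= phi i)%R by rewrite -lee_fin; exact: le_trans (fphi i).
have psi0 i : (0 <= psi i)%R.
  by rewrite -lee_fin; apply: le_trans (gpsi i); apply: integral_ge0 => x _; rewrite lee_fin.
have cp0 i k : 0 <= (c i k * phi i)%:E by rewrite lee_fin mulr_ge0.
have mfA i : measurable_fun (A i) (fun x => (f x)%:E).
  by apply: measurable_funTS; exact/measurable_EFinP.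
have mgA i : measurable_fun (A i) (fun x => (g x)%:E).
  by apply: measurable_funTS; exact/measurable_EFinP.
have H0 y : 0 <= \int[mu]_x (h x y)%:E by apply: integral_ge0 => x _; rewrite lee_fin.
apply: le_trans (ge0_integral_le_bigcup mA tA A0 H0) _.
apply: lee_nneseries => [k _ _|k _]; first exact: integral_ge0.
pose W := \sum_(i <oo) (c i k * phi i)%:E.
have W0 : 0 <= W by apply: nneseries_ge0.
apply: (@le_trans _ _ (\int[mu]_(y in A k) ((g y)%:E * W))).
  apply: ge0_le_integral_nm => // y Ay.
  apply: le_trans (ge0_integral_le_bigcup mA tA A0 _) _ => [x|]; first by rewrite lee_fin.
  rewrite /W -nneseriesZl//; apply: lee_nneseries => [i _ _|i _].
    by apply: integral_ge0 => x _; rewrite lee_fin.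
  apply: (@le_trans _ _ (\int[mu]_(x in A i) ((c i k * g y)%:E * (f x)%:E))).
    apply: ge0_le_integral_nm => x Ax; rewrite ?lee_fin//.
    by rewrite mulrAC; exact: hc.
  rewrite ge0_integralZl_EFin//; last 2 first.
  - by move=> x _; rewrite lee_fin.
  - by rewrite mulr_ge0.
  apply: le_trans (lee_wpmul2l _ (fphi i)) _; first by rewrite lee_fin mulr_ge0.
  by rewrite -!EFinM lee_fin mulrCA mulrA.
rewrite ge0_integralZr//; last by move=> x _; rewrite lee_fin.
apply: le_trans (lee_wpmul2r W0 (gpsi k)) _.
rewrite /W -nneseriesZl//; under eq_eseriesr do rewrite -EFinM mulrC.
exact: lexx.
Qed.

(** * Decomposition of the form into annuli *)

Section ball_decay.
Context (R : realType) (n : nat) (n_gt0 : (0 < n)%N).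
Local Notation mu := (lebesgue R n).
Local Notation dball j := (@eball0 R n (dyadic R (j + 1)%R)).

Lemma lebesgue_annulus_gt0 (j : int) : 0 < mu (@annulus R n j).
Proof.
apply: lt_le_trans (lebesgue_annulus_ge R j n_gt0).
by rewrite lte_fin exprn_gt0// divr_gt0 ?dyadic_gt0// sqrtr_gt0 ltr0n.
Qed.

Lemma sub_annulus_ball j : @annulus R n j `<=` dball j.
Proof. by rewrite annulusE; exact: subDsetl. Qed.

Lemma setD_ball_annulus j : dball j `\` @annulus R n j = eball0 (dyadic R j).
Proof.
rewrite annulusE setDDr setDv set0U; apply/setIidPr => x /= xj.
by rewrite /eball0 /= (lt_trans xj)// dyadicS ltr_pMl ?dyadic_gt0// ltr1n.
Qed.

Lemma annuli_enum_trivIset : trivIset setT (fun i => @annulus R n (zenum i)).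
Proof.
apply/trivIsetP => i k _ _ ik; apply/seteqP; split => // x [/= xi xk].
move/eqP: ik; apply; have [_ inj _] := zenum_bij.
by apply: inj; rewrite ?inE//; exact: annulus_inj xi xk.
Qed.

(** Index [j] stands for the ball of radius 2^(j+1), whose outermost shell is [annulus j]. Under
    [AC] no information is lost by [fine], as [ball_gaugeE] shows. *)
Definition ball_gauge (q v : Rn R n -> R) (j : int) : R :=
  fine (gauge mu (dball j) q v).

Section conjugate_weights.
Variables (q1 q2 v1 v2 : Rn R n -> R) (Q C : R).
Hypotheses (mq1 : measurable_fun setT q1) (mq2 : measurable_fun setT q2).
Hypotheses (q1_ge1 : forall x, (1 <= q1 x)%R) (q2_ge1 : forall x, (1 <= q2 x)%R).
Hypotheses (q1Q : forall x, (q1 x <= Q)%R) (q2Q : forall x, (q2 x <= Q)%R).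
Hypothesis q12 : forall x, ((q1 x)^-1 + (q2 x)^-1 = 1)%R.
Hypotheses (mv1 : measurable_fun setT v1) (mv2 : measurable_fun setT v2).
Hypotheses (v1_gt0 : forall x, (0 < v1 x)%R) (v2_gt0 : forall x, (0 < v2 x)%R).
Hypothesis v12 : forall x, (v1 x * v2 x = 1)%R.
Hypothesis C_gt0 : (0 < C)%R.
Hypothesis AC : forall b : R, (0 < b)%R ->
  gauge mu (eball0 b) q1 v1 * gauge mu (eball0 b) q2 v2 <= (C * b ^+ n)%:E.

(** Both gauges are positive because the ball has positive measure; their product being finite,
    neither is infinite. The factor 2^n comes from the radius 2^(j+1). *)
Lemma ball_gaugeE j :
  [/\ gauge mu (dball j) q1 v1 = (ball_gauge q1 v1 j)%:E,
      gauge mu (dball j) q2 v2 = (ball_gauge q2 v2 j)%:E,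
      (0 < ball_gauge q1 v1 j)%R, (0 < ball_gauge q2 v2 j)%R &
      (ball_gauge q1 v1 j * ball_gauge q2 v2 j <= C * 2 ^+ n * dyadic R j ^+ n)%R].
Proof.
have B0 : 0 < mu (dball j).
  apply: lt_le_trans (lebesgue_annulus_gt0 j) _; apply: le_measure; rewrite ?inE.
  - exact: measurable_annulus.
  - exact: measurable_eball0.
  - exact: sub_annulus_ball.
have mB : measurable (dball j) by exact: measurable_eball0.
have g1 : 0 < gauge mu (dball j) q1 v1 by exact: gauge_gt0.
have g2 : 0 < gauge mu (dball j) q2 v2 by exact: gauge_gt0.
have := AC (dyadic_gt0 R (j + 1)); rewrite /ball_gauge.
case: (gauge mu (dball j) q1 v1) g1 => [a||]//;
  case: (gauge mu (dball j) q2 v2) g2 => [b||]//.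
- rewrite !lte_fin -EFinM lee_fin => b0 a0 H; split => //=.
  by rewrite -mulrA -exprMn -dyadicS.
- by move=> _ a0; rewrite gt0_muley// leye_eq.
- by move=> a0 _; rewrite gt0_mulye// leye_eq.
Qed.

(** The second term compares the lower bound (2^j / sqrt n)^n for the measure of the annulus with
    the upper bound C 2^n 2^(jn) for the product of the two gauges. The minimum with 1 meets the
    condition [c <= 1] of [gauge_setD_le]. *)
Definition annulus_density : R :=
  Num.min 1%R (C * 2 ^+ n * Num.sqrt n%:R ^+ n)^-1%R.

Definition ball_ratio := doubling_ratio Q annulus_density.

Lemma annulus_density_itv : (0 < annulus_density <= 1)%R.
Proof.
rewrite /annulus_density ge_min lexx andbT lt_min ltr01 invr_gt0.
by rewrite !mulr_gt0 ?exprn_gt0// sqrtr_gt0 ltr0n.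
Qed.

Lemma ball_ratio_itv : (0 < ball_ratio < 1)%R.
Proof.
apply: doubling_ratio_itv annulus_density_itv.
exact: le_trans (q1_ge1 point) (q1Q point).
Qed.

Lemma annulus_density_le j :
  (annulus_density * (ball_gauge q1 v1 j * ball_gauge q2 v2 j))%:E
    <= mu (annulus j).
Proof.
have [_ _ g1 g2 g12] := ball_gaugeE j.
apply: le_trans (lebesgue_annulus_ge R j n_gt0); rewrite lee_fin.
have s0 : (0 < Num.sqrt n%:R ^+ n :> R)%R by rewrite exprn_gt0// sqrtr_gt0 ltr0n.
have d0 : (0 < C * 2 ^+ n)%R by rewrite mulr_gt0// exprn_gt0.
apply: (@le_trans _ _ ((C * 2 ^+ n * Num.sqrt n%:R ^+ n)^-1 *
    (C * 2 ^+ n * dyadic R j ^+ n))%R).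
  have /andP[a0 _] := annulus_density_itv; apply: ler_pM => //.
  - exact: ltW.
  - exact: mulr_ge0 (ltW g1) (ltW g2).
  - by rewrite /annulus_density ge_min lexx orbT.
rewrite expr_div_n; move: s0 d0; move: (Num.sqrt _ ^+ n)%R (C * 2 ^+ n)%R => s c s0 c0.
rewrite invfM mulrACA mulVf ?gt_eqF// mul1r mulrC.
by rewrite lexx.
Qed.

(** The ball of index [j] is the ball of index [j + 1] without its annulus, and that annulus is
    large enough for [gauge_setD_le]. *)
Lemma ball_gauge_step j :
  (ball_gauge q2 v2 j <= ball_ratio * ball_gauge q2 v2 (j + 1))%R.
Proof.
have [_ g2E _ g2 _] := ball_gaugeE j.
have [h1E h2E h1 h2 _] := ball_gaugeE (j + 1).
rewrite -lee_fin -g2E -setD_ball_annulus.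
apply: (@gauge_setD_le _ _ _ _ q1 q2 mq1 mq2 q1_ge1 q2_ge1 q12 _ _ v1 v2 _
  (ball_gauge q1 v1 (j + 1))) => //.
- exact: measurable_eball0.
- exact: measurable_annulus.
- exact: sub_annulus_ball.
- exact: annulus_density_itv.
- apply: modular_gauge h1E => //; first exact: measurable_eball0.
  by move=> x _; exact: ltW.
- apply: modular_gauge h2E => //; first exact: measurable_eball0.
  by move=> x _; exact: ltW.
- exact: annulus_density_le.
Qed.

Lemma ball_gauge_decay (j k : int) : (j <= k)%R ->
  (ball_gauge q2 v2 j <= ball_ratio ^+ `|j - k|%N * ball_gauge q2 v2 k)%R.
Proof.
move=> jk; have {jk}[m ->] : exists m : nat, k = (j + m%:Z)%R.
  by exists `|k - j|%N; rewrite gez0_abs ?subr_ge0// [RHS]addrC subrK.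
have -> : absz (j - (j + m%:Z))%R = m by rewrite opprD addNKr abszN absz_nat.
elim: m => [|m IH]; first by rewrite expr0 mul1r addr0.
apply: le_trans IH _; have /andP[r0 _] := ball_ratio_itv.
rewrite exprSr -mulrA ler_wpM2l ?exprn_ge0 ?(ltW r0)//.
by rewrite -addn1 PoszD addrA; exact: ball_gauge_step.
Qed.

Lemma ball_gauge_modular j :
  modular mu (dball j) q2 (fun x => v2 x / ball_gauge q2 v2 j)%R <= 1.
Proof.
have [_ gE _ g0 _] := ball_gaugeE j.
apply: modular_gauge gE => //; first exact: measurable_eball0.
by move=> x _; exact: ltW.
Qed.

(** A local Hoelder inequality: Young's inequality for f v1 and v2 at the scales M^t and U, where
    [t j] is nearly [1 / q1] on the annulus. Then M^t behaves like the norm of f v1 there, while the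
    M are summable like modulars. *)
Lemma annuli_integral_le (U t : int -> R) (L : R) (f : Rn R n -> R) :
  (forall j, 0 < U j)%R ->
  (forall j, modular mu (dball j) q2 (fun x => v2 x / U j)%R <= 1) ->
  (forall j, 0 <= t j <= 1)%R ->
  (forall j x, annulus j x -> `|1 - t j * q1 x| * `|j|%N%:R <= L)%R ->
  measurable_fun setT f -> (forall x, 0 <= f x)%R ->
  modular mu setT q1 (fun x => f x * v1 x)%R <= 1 ->
  exists M : nat -> R, [/\ forall i, (0 < M i <= 2)%R,
    \sum_(i <oo) (M i)%:E <= 5%:E &
    forall i, \int[mu]_(x in annulus (zenum i)) (f x)%:E <=
      ((2 * 2 `^ L + 1) * (M i `^ t (zenum i) * U (zenum i)))%:E].
Proof.
move=> U0 mU t01 tL mf f0 fm.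
have mfv : measurable_fun setT (fun x => f x * v1 x)%R by exact: measurable_funM.
have fv0 x : (0 <= f x * v1 x)%R by rewrite mulr_ge0 ?f0// ltW.
pose m i := modular mu (annulus (zenum i)) q1 (fun x => f x * v1 x)%R.
have mint : measurable_fun setT (fun x => ((f x * v1 x) `^ q1 x)%:E).
  exact: measurable_modular_integrand.
have sm : \sum_(i <oo) m i <= 1.
  rewrite /m /modular -ge0_integral_bigcup//; last 4 first.
  - by move=> i; exact: measurable_annulus.
  - exact: measurable_funTS.
  - by move=> x _; rewrite lee_fin powR_ge0.
  - exact: annuli_enum_trivIset.
  apply: le_trans fm; apply: ge0_subset_integral => //.
  - by apply: bigcup_measurable => i _; exact: measurable_annulus.
  - by move=> x _; rewrite lee_fin powR_ge0.
have m0 i : 0 <= m i by exact: modular_ge0.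
have m1 i : m i <= 1.
  apply: le_trans fm; apply: ge0_subset_integral => //.
  - exact: measurable_annulus.
  - by move=> x _; rewrite lee_fin powR_ge0.
have mE i : m i = (fine (m i))%:E.
  by rewrite fineK// ge0_fin_numE// (le_lt_trans (m1 i))// ltry.
(* The added 2^-|j| provides the lower bound on [M] that [modular_rescale_le] demands. Its total is
   at most 4, and the modulars add up to at most 1, hence the 5. *)
pose M i := (fine (m i) + 2^-1 ^+ `|zenum i|%N)%R.
have h0 i : (0 < 2^-1 ^+ `|zenum i|%N :> R)%R by rewrite exprn_gt0.
have h1 i : (2^-1 ^+ `|zenum i|%N <= 1 :> R)%R by rewrite exprn_ile1// invf_le1 ?ler1n.
have fm0 i : (0 <= fine (m i))%R by rewrite -lee_fin -mE.
have fm1 i : (fine (m i) <= 1)%R by rewrite -lee_fin -mE.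
have M0 i : (0 < M i)%R by rewrite ltr_wpDl.
exists M; split.
- by move=> i; rewrite M0 /M; have := fm1 i; have := h1 i; lra.
- rewrite (@eq_eseriesr _ _ (fun i => m i + (2^-1 ^+ `|zenum i|%N)%:E)); last first.
    by move=> i _; rewrite mE /M EFinD.
  rewrite nneseriesD//.
  have : \sum_(i <oo) (2^-1 ^+ `|zenum i|%N)%:E <= (2 / (1 - 2^-1))%:E :> \bar R.
    rewrite (@eq_eseriesr _ _ (fun i => (2^-1 ^+ `|zenum i - 0|%N)%:E)).
      by apply: dyadic_series; apply/andP; split; lra.
    by move=> i _; rewrite subr0.
  move=> H; apply: le_trans (leeD sm H) _; rewrite -EFinD lee_fin.
  by rewrite (_ : 1 - 2^-1 = 2^-1)%R ?invrK; lra.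
- move=> i; set j := zenum i.
  have a0 : (0 < M i `^ t j)%R by rewrite powR_gt0.
  have mA : measurable (@annulus R n j) by exact: measurable_annulus.
  rewrite (@eq_integral _ _ _ _ _ (fun x => (f x * v1 x * v2 x)%:E)); last first.
    by move=> x _; rewrite -mulrA v12 mulr1.
  apply: le_trans (@young_integral _ _ _ _ q1 q2 mq1 mq2 q1_ge1 q2_ge1 q12 _
    (fun x => f x * v1 x)%R v2 (M i `^ t j) (U j) mA mfv mv2
    (fun x _ => fv0 x) (fun x _ => ltW (v2_gt0 x)) a0 (U0 j)) _.
  rewrite [in leRHS]EFinM [leRHS]muleC lee_pmul2l//; last by rewrite lte_fin mulr_gt0.
  rewrite EFinD; apply: leeD.
  + apply: (@modular_rescale_le _ _ _ _ _ _ _ _ 0 _ `|j|%N%:R) => //.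
    * rewrite powRN powR_mulrn// -exprVn /M lerDr fm0/=.
      by have := fm1 i; have := h1 i; rewrite -/j; lra.
    * by move=> x jx; exact: tL.
    * by rewrite -/(m i) mE lee_fin lerDl ltW.
  + apply: (@le_trans _ _ (modular mu (dball j) q2 (fun x => v2 x / U j)%R)).
      have mB : measurable (dball j) by exact: measurable_eball0.
      have mvU := measurable_funM mv2 (measurable_cst (U j)^-1%R).
      apply: (ge0_subset_integral _ mA mB
        (measurable_modular_integrand mq2 q2_ge1 mvU)).
        by move=> x _; rewrite lee_fin powR_ge0.
      exact: sub_annulus_ball.
    exact: mU.
Qed.

End conjugate_weights.
End ball_decay.

Lemma absz_sub_sign (j k : int) : ((j < 0) != (k < 0))%R ->
  `|j - k|%N = (`|j| + `|k|)%N.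
Proof. by case: (leP 0%R j) => j0; case: (leP 0%R k) => k0 //= _; lia. Qed.

(** * Bound of the form by a convergent double series *)

Section hilbert_form.
Context (R : realType) (n : nat) (n_gt0 : (0 < n)%N).
Local Notation mu := (lebesgue R n).

Lemma powR_convex_le (t a b : R) : (0 <= t <= 1)%R -> (0 < a)%R -> (0 < b)%R ->
  (a `^ t * b `^ (1 - t) <= a + b)%R.
Proof.
move=> /andP[t0 t1] a0 b0; set c := Num.max a b.
have c0 : (0 < c)%R by rewrite lt_max a0.
have ac : (a <= c)%R by rewrite le_max lexx.
have bc : (b <= c)%R by rewrite le_max lexx orbT.
apply: (@le_trans _ _ c); last by rewrite ge_max lerDl lerDr (ltW a0) (ltW b0).
have -> : (c = c `^ t * c `^ (1 - t))%R.
  rewrite -powRD ?subrKC ?powRr1 ?(ltW c0)//.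
  by apply/implyP => _; rewrite gt_eqF.
by rewrite ler_pM ?powR_ge0// ge0_ler_powR ?nnegrE ?subr_ge0// ltW.
Qed.

Lemma lebesgue_annuli_setC :
  mu (~` \bigcup_i @annulus R n (zenum i)) = 0.
Proof.
rewrite (_ : ~` _ = [set x | enorm x = 0%R]); first exact: lebesgue_origin.
apply/seteqP; split => x /=.
  move=> xA; apply/eqP; rewrite eq_le enorm_ge0 andbT leNgt; apply/negP => x0.
  have [j jx] := annulus_cover x0; apply: xA.
  have [_ _ /(_ j I)[i _ ij]] := zenum_bij.
  by exists i => //; rewrite ij.
move=> x0 [i _] /andP[xi _].
by have := lt_le_trans (dyadic_gt0 R (zenum i)) xi; rewrite x0 ltxx.
Qed.

Variables (q1 q2 v1 v2 : Rn R n -> R) (C r : R).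
Hypotheses (mq1 : measurable_fun setT q1) (mq2 : measurable_fun setT q2).
Hypotheses (q1_ge1 : forall x, (1 <= q1 x)%R) (q2_ge1 : forall x, (1 <= q2 x)%R).
Hypothesis q12 : forall x, ((q1 x)^-1 + (q2 x)^-1 = 1)%R.
Hypotheses (mv1 : measurable_fun setT v1) (mv2 : measurable_fun setT v2).
Hypotheses (v1_gt0 : forall x, (0 < v1 x)%R) (v2_gt0 : forall x, (0 < v2 x)%R).
Hypothesis v12 : forall x, (v1 x * v2 x = 1)%R.
Hypothesis C_ge0 : (0 <= C)%R.
Variables U1 U2 : int -> R.
Hypotheses (U1_gt0 : forall j, (0 < U1 j)%R) (U2_gt0 : forall j, (0 < U2 j)%R).
Hypothesis mU1 : forall j,
  modular mu (eball0 (dyadic R (j + 1)%R)) q1 (fun x => v1 x / U1 j)%R <= 1.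
Hypothesis mU2 : forall j,
  modular mu (eball0 (dyadic R (j + 1)%R)) q2 (fun x => v2 x / U2 j)%R <= 1.
Hypothesis U12 : forall j, (U1 j * U2 j <= C * dyadic R j ^+ n)%R.
Hypothesis r01 : (0 < r < 1)%R.
Hypothesis U1_decay : forall j k, (j <= k)%R -> (U1 j <= r ^+ `|j - k|%N * U1 k)%R.
Hypothesis U2_decay : forall j k, (j <= k)%R -> (U2 j <= r ^+ `|j - k|%N * U2 k)%R.

Let q21 x : ((q2 x)^-1 + (q1 x)^-1 = 1)%R. Proof. by rewrite addrC. Qed.
Let v21 x : (v2 x * v1 x = 1)%R. Proof. by rewrite mulrC. Qed.

Definition kernel_bound (j k : int) : R :=
  ((Num.max (dyadic R j) (dyadic R k)) ^+ n)^-1%R.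

Lemma kernel_boundP (j k : int) (x y : Rn R n) : annulus j x -> annulus k y ->
  ((enorm x ^+ n + enorm y ^+ n)^-1 <= kernel_bound j k)%R.
Proof.
move=> /andP[jx _] /andP[ky _].
have x0 : (0 < enorm x)%R by apply: lt_le_trans jx; exact: dyadic_gt0.
have y0 : (0 < enorm y)%R by apply: lt_le_trans ky; exact: dyadic_gt0.
rewrite /kernel_bound lef_pV2 ?posrE ?exprn_gt0 ?addr_gt0 ?exprn_gt0//; last first.
  by rewrite lt_max dyadic_gt0.
rewrite maxEle; case: ifPn => _.
  apply: (@le_trans _ _ (enorm y ^+ n)%R); last by rewrite lerDr exprn_ge0// ltW.
  by rewrite lerXn2r ?nnegrE ?(ltW y0)// ltW// dyadic_gt0.
apply: (@le_trans _ _ (enorm x ^+ n)%R); last by rewrite lerDl exprn_ge0// ltW.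
by rewrite lerXn2r ?nnegrE ?(ltW x0)// ltW// dyadic_gt0.
Qed.

(** If j <= k, decay replaces [U2 j] by r^|j-k| [U2 k], and the product [U1 k * U2 k] is compensated
    by the kernel 2^(-kn). If k < j, it is [U1] that moves, from [k] to [j]. *)
Lemma kernel_gauge_le (j k : int) :
  (kernel_bound j k * (U2 j * U1 k) <= C * r ^+ `|j - k|%N)%R.
Proof.
have /andP[r0 r1] := r01.
have rn0 : (0 <= r ^+ `|j - k|%N)%R by rewrite exprn_ge0// ltW.
have dj i : (0 < dyadic R i ^+ n)%R by rewrite exprn_gt0// dyadic_gt0.
have [jk|kj] := leP j k.
  rewrite /kernel_bound max_r ?le_dyadic// mulrC ler_pdivrMr//.
  apply: le_trans (ler_wpM2r (ltW (U1_gt0 k)) (U2_decay jk)) _.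
  rewrite -mulrA [(U2 k * _)%R]mulrC.
  apply: le_trans (ler_wpM2l rn0 (U12 k)) _.
  by rewrite mulrCA mulrA.
rewrite /kernel_bound max_l ?le_dyadic ?(ltW kj)// mulrC ler_pdivrMr//.
apply: le_trans (ler_wpM2l (ltW (U2_gt0 j)) (U1_decay (ltW kj))) _.
rewrite distnC mulrCA [(U2 j * _)%R]mulrC.
apply: le_trans (ler_wpM2l rn0 (U12 j)) _.
by rewrite mulrCA mulrA.
Qed.

Variables (t0 t1 L : R).
Hypotheses (t0_itv : (0 <= t0 <= 1)%R) (t1_itv : (0 <= t1 <= 1)%R).
Let t (j : int) : R := if (j < 0)%R then t0 else t1.
Hypothesis tL1 : forall j x, annulus j x ->
  (`|1 - t j * q1 x| * `|j|%N%:R <= L)%R.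
Hypothesis tL2 : forall j x, annulus j x ->
  (`|1 - (1 - t j) * q2 x| * `|j|%N%:R <= L)%R.

Let t_itv j : (0 <= t j <= 1)%R. Proof. by rewrite /t; case: ifP. Qed.

(** For indices of the same sign the two exponents add up to 1 and [powR_convex_le] applies.
    Otherwise each power is merely bounded by 2, and the decay splits because |j-k| = |j| + |k|. *)
Lemma mixed_exponents_le (j k : int) (a b : R) :
  (0 < a <= 2)%R -> (0 < b <= 2)%R ->
  (r ^+ `|j - k|%N * (a `^ t j * b `^ (1 - t k)) <=
    (a + b) * r ^+ `|j - k|%N + 4 * (r ^+ `|j|%N * r ^+ `|k|%N))%R.
Proof.
move=> /andP[a0 a2] /andP[b0 b2].
have /andP[r0 r1] : (0 < r < 1)%R by exact: r01.
have rn0 m : (0 <= r ^+ m)%R by rewrite exprn_ge0// ltW.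
have [jk|jk] := boolP ((j < 0) == (k < 0))%R.
  rewrite [leLHS]mulrC ler_wpDr// ?mulr_ge0//.
  rewrite ler_wpM2r// /t -(eqP jk).
  by apply: powR_convex_le => //; case: ifP.
rewrite ler_wpDl// ?mulr_ge0 ?addr_ge0 ?(ltW a0) ?(ltW b0)//.
rewrite absz_sub_sign// exprD mulrC ler_wpM2r ?mulr_ge0//.
have pw c s : (0 < c <= 2)%R -> (0 <= s <= 1)%R -> (c `^ s <= 2)%R.
  move=> /andP[c0 c2] /andP[s0 s1]; apply: (@le_trans _ _ (2 `^ s)%R).
    by rewrite ge0_ler_powR ?nnegrE// ltW.
  by rewrite -[leRHS]powRr1// ler_powR// ler1n.
rewrite (_ : 4 = 2 * 2)%R; last by rewrite -natrM.
apply: ler_pM; rewrite ?powR_ge0 ?pw ?a0 ?b0//.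
by have /andP[? ?] := t_itv k; apply/andP; split; lra.
Qed.

(** The square comes from the two local estimates [annuli_integral_le], [C] from [kernel_gauge_le],
    and the bracket from [double_series_le] with [S0 = 5] and [S = 2 / (1 - r)]. *)
Definition hilbert_constant : R :=
  ((2 * 2 `^ L + 1) ^+ 2 * C *
   (5 * (2 / (1 - r)) + 5 * (2 / (1 - r)) + 4 * (2 / (1 - r) * (2 / (1 - r)))))%R.

Lemma hilbert_form_le (f g : Rn R n -> R) :
  measurable_fun setT f -> measurable_fun setT g ->
  (forall x, 0 <= f x)%R -> (forall x, 0 <= g x)%R ->
  modular mu setT q1 (fun x => f x * v1 x)%R <= 1 ->
  modular mu setT q2 (fun x => g x * v2 x)%R <= 1 ->
  \int[mu]_y \int[mu]_x (f x * g y / (enorm x ^+ n + enorm y ^+ n))%:E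
    <= hilbert_constant%:E.
Proof.
move=> mf mg f0 g0 fm gm.
have ritv : (0 < r < 1)%R by exact: r01.
have /andP[r0 r1] := ritv.
have t'_itv j : (0 <= 1 - t j <= 1)%R.
  by have /andP[? ?] := t_itv j; apply/andP; split; lra.
(* The integrals of [f] are measured by [U2] with exponents [t]; those of [g], with the roles
   exchanged, by [U1] with exponents [1 - t]. *)
have [M [M0 MS Mf]] := annuli_integral_le mq1 mq2 q1_ge1 q2_ge1
  q12 mv1 mv2 v1_gt0 v2_gt0 v12 U2_gt0 mU2 t_itv tL1 mf f0 fm.
have [M' [M'0 M'S Mg]] := annuli_integral_le mq2 mq1 q2_ge1 q1_ge1
  q21 mv2 mv1 v2_gt0 v1_gt0 v21 U1_gt0 mU1 t'_itv tL2 mg g0 gm.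
have kb0 j k : (0 <= kernel_bound j k)%R.
  by rewrite /kernel_bound invr_ge0 exprn_ge0// le_max ltW ?dyadic_gt0.
apply: le_trans (@double_integral_le_series _ _ _ mu
  (fun i => @annulus R n (zenum i))
  (fun x y => f x * g y / (enorm x ^+ n + enorm y ^+ n))%R f g
  (fun i k => kernel_bound (zenum i) (zenum k)) _ _ _ (@annuli_enum_trivIset R n)
  lebesgue_annuli_setC mf mg f0 g0 _ _ _ Mf Mg) _.
- by move=> k; exact: measurable_annulus.
- by move=> i k; exact: kb0.
- move=> x y; apply: divr_ge0; first exact: mulr_ge0.
  by apply: addr_ge0; apply: exprn_ge0; exact: enorm_ge0.
- move=> i k x y xi yk; rewrite mulrC -mulrA.
  by apply: ler_wpM2r; [rewrite mulr_ge0|exact: kernel_boundP].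
set K := (2 * 2 `^ L + 1)%R; have K0 : (0 <= K)%R.
  by rewrite /K addr_ge0// mulr_ge0// powR_ge0.
have KC0 : (0 <= K ^+ 2 * C)%R by rewrite mulr_ge0// exprn_ge0.
pose w i k := (r ^+ `|zenum i - zenum k|%N)%R.
pose u i := (r ^+ `|zenum i|%N)%R.
have rn0 m : (0 <= r ^+ m)%R by rewrite exprn_ge0// ltW.
have MM0 i : (0 <= M i)%R by have /andP[/ltW] := M0 i.
have MM'0 i : (0 <= M' i)%R by have /andP[/ltW] := M'0 i.
have bd0 k i : (0 <= (M i + M' k) * w i k + 4 * (u i * u k))%R.
  apply: addr_ge0; first by apply: mulr_ge0; [exact: addr_ge0|exact: rn0].
  by apply: mulr_ge0 => //; apply: mulr_ge0; exact: rn0.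
have tm0 i k : (0 <= kernel_bound (zenum i) (zenum k) *
    (K * (M i `^ t (zenum i) * U2 (zenum i))) *
    (K * (M' k `^ (1 - t (zenum k)) * U1 (zenum k))))%R.
  rewrite mulr_ge0//; first rewrite mulr_ge0//.
    by rewrite mulr_ge0// mulr_ge0 ?powR_ge0// ltW.
  by rewrite mulr_ge0// mulr_ge0 ?powR_ge0// ltW.
apply: (@le_trans _ _ (\sum_(k <oo) \sum_(i <oo) ((K ^+ 2 * C)%:E *
    ((M i + M' k) * w i k + 4 * (u i * u k))%:E))).
  apply: lee_nneseries => [k _ _|k _].
    by apply: nneseries_ge0 => i _ _; rewrite lee_fin; exact: tm0.
  apply: lee_nneseries => [i _ _|i _]; first by rewrite lee_fin; exact: tm0.
  rewrite -EFinM lee_fin.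
  set gj := U2 _; set gk := U1 _.
  set a := (M i `^ _)%R; set b := (M' k `^ _)%R.
  have -> : (kernel_bound (zenum i) (zenum k) * (K * (a * gj)) * (K * (b * gk)) =
    K ^+ 2 * ((kernel_bound (zenum i) (zenum k) * (gj * gk)) * (a * b)))%R by ring.
  rewrite -[leRHS]mulrA; apply: ler_wpM2l; first exact: exprn_ge0.
  apply: (@le_trans _ _ (C * w i k * (a * b))%R).
    apply: ler_wpM2r; first by rewrite mulr_ge0// powR_ge0.
    exact: kernel_gauge_le.
  rewrite -mulrA; apply: ler_wpM2l => //.
  exact: mixed_exponents_le.
rewrite (@eq_eseriesr _ _ (fun k => (K ^+ 2 * C)%:E *
    \sum_(i <oo) ((M i + M' k) * w i k + 4 * (u i * u k))%:E)); last first.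
  by move=> k _; rewrite nneseriesZl// => i _; rewrite lee_fin.
rewrite nneseriesZl; last by move=> k _; apply: nneseries_ge0 => i _ _; rewrite lee_fin.
rewrite /hilbert_constant -/K [in leRHS]EFinM lee_wpmul2l ?lee_fin//.
apply: double_series_le => //.
- by move=> i; exact: rn0.
- by move=> i k; exact: rn0.
- by move=> i k; rewrite /w distnC.
- have := dyadic_series 0 ritv; rewrite /u; apply: le_trans.
  by under [in leRHS]eq_eseriesr do rewrite subr0.
- by move=> k; exact: dyadic_series.
Qed.

End hilbert_form.

(** * Null sets, scaling and approximation of products *)

Section almost_everywhere.
Context d (T : measurableType d) (R : realType).
Variable mu : {measure set T -> \bar R}.

Import HBNNSimple.

Lemma ge0_integral_setD_null (N : set T) (f : T -> \bar R) :
  measurable N -> mu N = 0 -> (forall x, 0 <= f x) ->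
  \int[mu]_x f x <= \int[mu]_(x in ~` N) f x.
Proof.
move=> mN N0 f0.
rewrite ge0_integralTE//; apply: ge_ereal_sup => /= _ [h hf <-].
rewrite -integralT_nnsfun (ge0_negligible_integral mN)//; last 2 first.
- by apply/measurable_EFinP.
- by move=> x _; rewrite lee_fin fun_ge0.
rewrite setTD; apply: ge0_le_integral_nm => x _; last exact: hf.
by rewrite lee_fin fun_ge0.
Qed.

Lemma ge0_ae_eq_integral_nm (f g : T -> \bar R) :
  (forall x, 0 <= f x) -> (forall x, 0 <= g x) ->
  {ae mu, forall x, f x = g x} -> \int[mu]_x f x = \int[mu]_x g x.
Proof.
move=> f0 g0 [N [mN N0 fgN]].
have half (a b : T -> \bar R) : (forall x, 0 <= a x) -> (forall x, 0 <= b x) ->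
    (forall x, ~ N x -> a x = b x) -> \int[mu]_x a x <= \int[mu]_x b x.
  move=> a0 b0 ab; apply: le_trans (ge0_integral_setD_null mN N0 a0) _.
  rewrite integral_mkcond; apply: ge0_le_integral_nm => x _.
    by apply: erestrict_ge0.
  by rewrite patchE; case: ifPn => // /set_mem Nx; rewrite ab.
have fg x : ~ N x -> f x = g x.
  by move=> Nx; apply: contrapT => fgx; exact/Nx/fgN.
apply/eqP; rewrite eq_le !half// => x Nx.
by rewrite fg.
Qed.

(** If a simple function lies below [c * f], dividing it by [c] gives a measurable function below
    [f]; linearity is used for that function only. *)
Lemma ge0_integralZl_nm (c : R) (f : T -> \bar R) : (0 < c)%R ->
  (forall x, 0 <= f x) ->
  \int[mu]_x (c%:E * f x) <= c%:E * \int[mu]_x f x.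
Proof.
move=> c0 f0; have cf0 x : 0 <= c%:E * f x by rewrite mule_ge0// lee_fin ltW.
rewrite ge0_integralTE//; apply: ge_ereal_sup => /= _ [h hf <-].
rewrite -integralT_nnsfun.
have mh : measurable_fun setT (fun x => (c^-1 * h x)%:E).
  by apply/measurable_EFinP; exact: measurable_funM.
have -> : \int[mu]_x (h x)%:E = c%:E * \int[mu]_x (c^-1 * h x)%:E.
  rewrite -ge0_integralZl_EFin ?(ltW c0)//; last first.
    by move=> x _; rewrite lee_fin mulr_ge0 ?invr_ge0 ?(ltW c0)//.
  by apply: eq_integral => x _; rewrite -EFinM mulVKf// gt_eqF.
apply: lee_wpmul2l; first by rewrite lee_fin ltW.
apply: ge0_le_integral_nm => x _; first by rewrite lee_fin mulr_ge0 ?invr_ge0 ?(ltW c0)//.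
by rewrite -(@lee_pmul2l _ c%:E) ?lte_fin// -EFinM mulVKf ?gt_eqF.
Qed.

End almost_everywhere.

(** Serves necessity, where extremizers exist only for reals strictly below the gauges, and the
    gauges may be infinite. *)
Lemma mule_le_approx (R : realType) (x y : \bar R) (D : R) :
  0 <= x -> 0 <= y -> (0 <= D)%R ->
  (forall a b : R, (0 < a)%R -> (0 < b)%R -> a%:E < x -> b%:E < y ->
    (a * b <= D)%R) ->
  x * y <= D%:E.
Proof.
move=> x0 y0 D0; wlog suff: x y x0 y0 / x = +oo -> (forall a b : R, (0 < a)%R ->
    (0 < b)%R -> a%:E < x -> b%:E < y -> (a * b <= D)%R) -> x * y <= D%:E.
  move=> inf H; have [xoo|xoo] := eqVneq x +oo; first exact: inf.
  have [yoo|yoo] := eqVneq y +oo.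
    by rewrite muleC; apply: inf => // a b a0 b0 ay bx; rewrite mulrC; exact: H.
  case: x x0 xoo H => [a||]//; case: y y0 yoo => [b||]//.
  rewrite !lee_fin => b0 _ a0 _ H; rewrite leNgt.
  apply/negP => Dab.
  have ab0 : (0 < a * b)%R by exact: le_lt_trans Dab.
  have a0' : (0 < a)%R.
    rewrite lt_neqAle a0 andbT eq_sym.
    by apply: contraTneq ab0 => ->; rewrite mul0r ltxx.
  have b0' : (0 < b)%R.
    rewrite lt_neqAle b0 andbT eq_sym.
    by apply: contraTneq ab0 => ->; rewrite mulr0 ltxx.
  (* The midpoint of rho = D/(ab) and 1 satisfies s^2 - rho = (1 - rho)^2 / 4 > 0, so shrinking both
     factors by s leaves a product above D. *)
  pose s := ((1 + D / (a * b)) / 2)%R.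
  have r1 : (D / (a * b) < 1)%R by rewrite ltr_pdivrMr// mul1r.
  have r0 : (0 <= D / (a * b))%R by rewrite divr_ge0// ltW.
  have s0 : (0 < s)%R by rewrite /s; lra.
  have s1 : (s < 1)%R by rewrite /s; lra.
  have : (a * s * (b * s) <= D)%R.
    by apply: H; rewrite ?lte_fin ?gtr_pMr// mulr_gt0.
  apply/negP; rewrite -ltNge mulrACA mulrC -ltr_pdivrMr// /s.
  by move: r0 r1; set rho := (D / _)%R => r0 r1; nra.
move=> -> H; have [->|y0'] := eqVneq y 0; first by rewrite mule0 lee_fin.
have {y0'}y0 : 0 < y by rewrite lt_neqAle y0 eq_sym y0'.
exfalso.
have [b b0 by_] : exists2 b : R, (0 < b)%R & b%:E < y.
  case: y y0 {H} => [b||]// b0; last by exists 1%R; rewrite ?ltry.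
  by exists (b / 2)%R; move: b0; rewrite !lte_fin => b0; lra.
have := H ((D + 1) / b)%R b _ b0 _ by_.
(* With [x] infinite, [a = (D + 1) / b] is allowed and yields the absurd D + 1 <= D. *)
rewrite divfK ?gt_eqF// ltry divr_gt0 ?ltr_wpDl// => /(_ isT isT).
by lra.
Qed.

(** Serves sufficiency: functions are normalised by numbers strictly above their gauges, which may
    be 0. *)
Lemma mulr_le_approx (R : realType) (K a b : R) (z : \bar R) :
  (0 <= K)%R -> (0 <= a)%R -> (0 <= b)%R -> 
  (forall l m : R, (a < l)%R -> (b < m)%R -> z <= (K * l * m)%:E) ->
  z <= (K * a * b)%:E.
Proof.
move=> K0 a0 b0 H; apply/lee_addgt0Pr => e e0.
(* As s <= 1, replacing a b by (a + s)(b + s) adds at most s (a + b + 1); the final + 1 keeps the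
   denominator positive when K = 0. *)
pose s := Num.min 1%R (e / (K * (a + b + 1) + 1))%R.
have Kab : (0 < K * (a + b + 1) + 1)%R by rewrite ltr_wpDl// mulr_ge0// !addr_ge0.
have s0 : (0 < s)%R by rewrite lt_min ltr01 divr_gt0.
have s1 : (s <= 1)%R by rewrite ge_min lexx.
have se : (s * (K * (a + b + 1) + 1) <= e)%R.
  by rewrite -ler_pdivlMr// ge_min lexx orbT.
apply: le_trans (H (a + s)%R (b + s)%R _ _) _; rewrite ?ltrDl//.
rewrite -EFinD lee_fin.
have : (0 <= K * s * (1 - s))%R by rewrite !mulr_ge0 ?subr_ge0// ltW.
nra.
Qed.

(** * The norms of the statement *)

Section norm_gauge.
Context (R : realType) (n : nat).
Local Notation mu := (lebesgue R n).

(** For each [l] the two integrands agree almost everywhere: off [D] the base is 0 and the positive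
    exponent makes the power 0. *)
Lemma vnorm_gauge (q : Rn R n -> R) (h : Rn R n -> \bar R) (k : Rn R n -> R)
    (D : set (Rn R n)) :
  (forall x, 0 < q x)%R -> (forall x, 0 <= k x)%R ->
  {ae mu, forall x, h x = (k x * \1_D x)%:E} ->
  vnorm q h = gauge mu D q k.
Proof.
move=> q0 k0 hk; congr ereal_inf; congr image; apply/funext => l /=.
apply: propext; split => -[l0 H]; split => //; move: H.
all: rewrite (@ge0_ae_eq_integral_nm _ _ _ mu _
  (((fun x => ((k x / l) `^ q x)%:E) \_ D)))//.
all: try by move=> x; exact: poweR_ge0.
all: try by move=> x; apply: erestrict_ge0 => y _; rewrite lee_fin powR_ge0.
all: try by rewrite -integral_mkcond.
all: apply: filterS hk => x ->; rewrite patchE indicE.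
all: have l1 : (0 <= l^-1)%R by rewrite invr_ge0 ltW.
all: case: ifPn => xD; rewrite ?mulr1 ?mulr0 inver gt_eqF// -EFinM poweR_EFin.
all: rewrite ?mul0r ?normr0 ?mul0r ?powR0 ?gt_eqF//.
all: by rewrite ger0_norm.
Qed.

End norm_gauge.

Lemma ltzN1 (j : int) : (j < -1)%R -> (j <= -2)%R.
Proof. lia. Qed.

Lemma eqzN1 (j : int) : (j < 0)%R -> (-1 < j + 1)%R -> j = (-1)%R.
Proof. lia. Qed.

(** * Conjugate exponents and log-Hoelder continuity *)

Section exponents.
Context (R : realType) (n : nat).
Implicit Types (p : Rn R n -> R).

Lemma exponent_inf_gt1 p : (forall x, 1 <= p x)%R -> 1 < exponent_inf p ->
  exists2 a : R, (1 < a)%R & forall x, (a <= p x)%R.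
Proof.
move=> p1; have lb x : exponent_inf p <= (p x)%:E.
  by apply: ereal_inf_lbound; exists x.
case: (exponent_inf p) lb => [a||] lb //; last by have := lb point.
by rewrite lte_fin => a1; exists a => // x; have := lb x; rewrite lee_fin.
Qed.

Lemma conjugateE p x : (1 < p x)%R -> conjugate p x = (p x / (p x - 1))%R.
Proof.
move=> p1; have p0 : (0 < p x)%R by exact: lt_trans p1.
rewrite /conjugate /hoelder_conjugate/= eqe gt_eqF//.
by rewrite -EFinB inver gt_eqF ?subr_gt0.
Qed.

Lemma conjugate_sum p x : (1 < p x)%R -> ((p x)^-1 + (conjugate p x)^-1 = 1)%R.
Proof.
move=> p1; have p0 : (0 < p x)%R by exact: lt_trans p1.
by rewrite conjugateE//; field; rewrite subr_eq0 !gt_eqF.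
Qed.

Lemma conjugate_bounds p x (a : R) : (1 < a)%R -> (a <= p x)%R ->
  (1 <= conjugate p x <= a / (a - 1))%R.
Proof.
move=> a1 ap; have p1 : (1 < p x)%R by exact: lt_le_trans ap.
rewrite conjugateE// ler_pdivlMr ?subr_gt0// mul1r gerBl ler01/=.
rewrite ler_pdivrMr ?subr_gt0// mulrAC ler_pdivlMr ?subr_gt0//.
by nra.
Qed.

Lemma measurable_conjugate p : measurable_fun setT p -> (forall x, 1 < p x)%R ->
  measurable_fun setT (conjugate p).
Proof.
move=> mp p1; rewrite (_ : conjugate p = fun x => p x * (p x - 1) `^ (-1))%R.
  apply: measurable_funM; first exact: mp.
  apply: (measurableT_comp (measurable_powR _)).
  exact: measurable_funB.
apply/funext => x; rewrite conjugateE// powR_inv1// subr_ge0 ltW//.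
Qed.

Definition dyadic_limit (p0 poo : R) (j : int) : R :=
  if (j < 0)%R then p0 else poo.

(* [ `|j| ] is comparable to [ `|ln |x|| ] on the annulus of index [j], so both
   log-Hoelder conditions become the same estimate. *)
Lemma log_hoelder_annulus p (P C0 Coo p0 poo : R) :
  (forall x, 1 <= p x <= P)%R ->
  (0 < C0)%R -> (1 <= p0)%R -> (0 < Coo)%R -> 
  (forall x, 0 < enorm x < 2^-1 -> `|p x - p0| <= C0 / - ln (enorm x))%R ->
  (forall x, `|p x - poo| <= Coo / ln (expR 1 + enorm x))%R ->
  exists2 L : R, (0 <= L)%R & forall j x, annulus j x ->
    (`|p x - dyadic_limit p0 poo j| * `|j|%N%:R <= L)%R.
Proof.
move=> pP C00 p01 Coo0 H0 Hoo.
have l2 : (0 < ln 2 :> R)%R by rewrite ln_gt0// ltr1n.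
have P1 : (1 <= P)%R by have /andP[a b] := pP point; exact: le_trans b.
(* The first term serves |x| < 1/2, the second j >= 0, and [P + p0] the remaining shell j = -1. *)
exists (2 * C0 / ln 2 + Coo / ln 2 + P + p0)%R.
  by rewrite !addr_ge0 ?divr_ge0 ?mulr_ge0//; lra.
move=> j x /andP[jx xj].
have x0 : (0 < enorm x)%R by apply: lt_le_trans jx; exact: dyadic_gt0.
have lx : (j%:~R * ln 2 <= ln (enorm x))%R.
  by rewrite -ln_powR ler_ln ?posrE ?powR_gt0.
have xl : (ln (enorm x) < (j + 1)%:~R * ln 2)%R.
  by rewrite -ln_powR ltr_ln ?posrE ?powR_gt0.
have B1 : (0 <= 2 * C0 / ln 2)%R by rewrite divr_ge0 ?mulr_ge0 ?ltW.
have B2 : (0 <= Coo / ln 2)%R by rewrite divr_ge0 ?ltW.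
rewrite /dyadic_limit; case: ifPn => j0; last first.
  rewrite -leNgt in j0.
  have le : (j%:~R * ln 2 <= ln (expR 1 + enorm x))%R.
    by apply: le_trans lx _; rewrite ler_ln ?posrE ?addr_gt0 ?expR_gt0// lerDr expR_ge0.
  have e0 : (0 < ln (expR 1 + enorm x))%R.
    by rewrite ln_gt0// ltr_wpDr ?(ltW x0)// expR_gt1.
  have -> : (`|j|%N%:R = j%:~R :> R)%R by rewrite -[in RHS](gez0_abs j0).
  have jR : (0 <= j%:~R :> R)%R by rewrite ler0z.
  apply: (@le_trans _ _ (Coo / ln 2)%R); last by lra.
  apply: le_trans (ler_wpM2r jR (Hoo x)) _.
  rewrite mulrAC ler_pdivrMr// mulrAC ler_pdivlMr// -mulrA.
  by rewrite ler_wpM2l// ltW.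
have [x2|x2] := ltP (enorm x) 2^-1%R.
  have j2 : (j <= -2)%R.
    have : (dyadic R j < dyadic R (-1))%R.
      by apply: le_lt_trans jx _; rewrite /dyadic mulrN1z powR_inv1.
    by move/dyadic_lt/ltzN1.
  have -> : (`|j|%N%:R = - j%:~R :> R)%R.
    by rewrite -[in RHS](opprK j) -(lez0_abs (ltW j0)) mulrNz opprK.
  have jR : (j%:~R <= -2 :> R)%R.
    by rewrite -(@ler_int R) in j2; rewrite (le_trans j2)// mulrNz.
  (* From ln |x| < (j+1) ln 2, since -j <= -2(j+1) when j <= -2. *)
  have jl : (- j%:~R * ln 2 <= 2 * - ln (enorm x))%R.
    move: xl; rewrite intrD => xl; nra.
  have nl : (0 < - ln (enorm x))%R by nra.
  apply: (@le_trans _ _ (2 * C0 / ln 2)%R); last by lra.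
  have jR0 : (0 <= - j%:~R :> R)%R by lra.
  apply: le_trans (ler_wpM2r jR0 (H0 x _)) _; first by rewrite x0.
  rewrite mulrAC ler_pdivrMr// mulrAC ler_pdivlMr//.
  by have := ler_wpM2l (ltW C00) jl; lra.
(* A negative index with |x| >= 1/2 leaves the shell 1/2 <= |x| < 1, beyond the range of the local
   condition; there boundedness of the exponent suffices. *)
have -> : j = (-1)%R.
  have : (dyadic R (-1) < dyadic R (j + 1))%R.
    by apply: le_lt_trans xj; rewrite /dyadic mulrN1z powR_inv1.
  by move/dyadic_lt; exact: eqzN1.
rewrite /= mulr1.
have /andP[a b] := pP x.
apply: (@le_trans _ _ (P + p0)%R); last by lra.
by rewrite ler_norml; apply/andP; split; lra.
Qed.

(** Up to sign both deviations are multiples of q - s: they equal (s-q)/s and (q-s)/(s(q-1)), where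
    1/s <= 1 and 1/(q-1) <= 1/(a-1). *)
Lemma exponent_deviation (a q s L m : R) : (1 < a)%R -> (a <= q)%R ->
  (1 <= s)%R -> (0 <= m)%R -> (`|q - s| * m <= L)%R ->
  (`|1 - s^-1 * q| * m <= L * (1 + (a - 1)^-1))%R /\
  (`|1 - (1 - s^-1) * (q / (q - 1))| * m <= L * (1 + (a - 1)^-1))%R.
Proof.
move=> a1 aq s1 m0 qL.
have s0 : (0 < s)%R by exact: lt_le_trans s1.
have L0 : (0 <= L)%R by apply: le_trans qL; rewrite mulr_ge0.
have a10 : (0 < (a - 1)^-1)%R by rewrite invr_gt0 subr_gt0.
have q10 : (0 < q - 1)%R by rewrite subr_gt0 (lt_le_trans a1).
have sV : (s^-1 <= 1)%R by rewrite invf_le1.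
have sV0 : (0 <= s^-1)%R by rewrite invr_ge0 ltW.
have qaV : ((q - 1)^-1 <= (a - 1)^-1)%R.
  by rewrite lef_pV2 ?posrE//; lra.
have D1 : (L <= L * (1 + (a - 1)^-1))%R by rewrite ler_peMr// lerDl ltW.
have D2 : (L * (a - 1)^-1 <= L * (1 + (a - 1)^-1))%R by rewrite ler_wpM2l// lerDr.
split.
  apply: le_trans D1; apply: le_trans qL; rewrite ler_wpM2r//.
  rewrite (_ : 1 - s^-1 * q = (s - q) * s^-1)%R; last by field; rewrite gt_eqF.
  by rewrite normrM distrC (ger0_norm sV0) ler_piMr.
apply: le_trans D2.
rewrite (_ : 1 - _ = (q - s) * (s^-1 * (q - 1)^-1))%R; last first.
  by field; rewrite !gt_eqF.
have k0 : (0 <= s^-1 * (q - 1)^-1)%R by rewrite mulr_ge0// invr_ge0 ltW.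
rewrite normrM (ger0_norm k0) mulrAC ler_pM// ?mulr_ge0//.
apply: le_trans qaV; rewrite ler_piMl// invr_ge0 ltW//.
Qed.

End exponents.

(** * The two implications for real-valued weights *)

Section hilbert_gauge.
Context (R : realType) (n : nat) (n_gt0 : (0 < n)%N).
Local Notation mu := (lebesgue R n).

(** Replacing the values 0 and [+oo] by 1 alters [w] on a null set only. *)
Lemma real_weight (w : Rn R n -> \bar R) : weight w ->
  exists v1 v2 : Rn R n -> R,
  [/\ measurable_fun setT v1, measurable_fun setT v2,
      forall x, (0 < v1 x)%R /\ (0 < v2 x)%R, forall x, (v1 x * v2 x = 1)%R &
      {ae mu, forall x, w x = (v1 x)%:E /\ (w x)^-1 = (v2 x)%:E}].
Proof.
move=> [mw w0 _ waefin].
pose v1 x : R := if 0 < w x < +oo then fine (w x) else 1%R.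
have v10 x : (0 < v1 x)%R.
  by rewrite /v1; case: ifPn => // wx; exact: fine_gt0.
have mv1 : measurable_fun setT v1.
  apply: measurable_fun_ifT.
  - apply: measurable_and.
      exact: measurable_fun_lte (measurable_cst _) mw.
    exact: measurable_fun_lte mw (measurable_cst _).
  - exact: measurableT_comp mw.
  - exact: measurable_cst.
exists v1, (fun x => v1 x `^ (-1))%R; split.
- exact: mv1.
- exact: (measurableT_comp (measurable_powR _)).
- by move=> x; split; [exact: v10|rewrite powR_gt0].
- by move=> x; rewrite powR_inv1 ?(ltW (v10 x))// mulfV// gt_eqF.
apply: filterS waefin => x wx.
have wE : w x = (v1 x)%:E.
  by rewrite /v1 wx; case: (w x) wx => [r|/andP[]|/andP[]].
split => //.
by rewrite wE inver gt_eqF// powR_inv1// ltW.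
Qed.

Variables (q1 q2 v1 v2 : Rn R n -> R) (Q : R).
Hypotheses (mq1 : measurable_fun setT q1) (mq2 : measurable_fun setT q2).
Hypotheses (q1_ge1 : forall x, (1 <= q1 x)%R) (q2_ge1 : forall x, (1 <= q2 x)%R).
Hypotheses (q1Q : forall x, (q1 x <= Q)%R) (q2Q : forall x, (q2 x <= Q)%R).
Hypothesis q12 : forall x, ((q1 x)^-1 + (q2 x)^-1 = 1)%R.
Hypotheses (mv1 : measurable_fun setT v1) (mv2 : measurable_fun setT v2).
Hypotheses (v1_gt0 : forall x, (0 < v1 x)%R) (v2_gt0 : forall x, (0 < v2 x)%R).
Hypothesis v12 : forall x, (v1 x * v2 x = 1)%R.

Let q21 x : ((q2 x)^-1 + (q1 x)^-1 = 1)%R. Proof. by rewrite addrC. Qed.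
Let v21 x : (v2 x * v1 x = 1)%R. Proof. by rewrite mulrC. Qed.

Definition hilbert_form (f g : Rn R n -> R) : \bar R :=
  \int[mu]_y \int[mu]_x (f x * g y / (enorm x ^+ n + enorm y ^+ n))%:E.

Lemma hilbert_integrand_ge0 (f g : Rn R n -> R) : (forall x, 0 <= f x)%R ->
  (forall x, 0 <= g x)%R ->
  forall x y, (0 <= f x * g y / (enorm x ^+ n + enorm y ^+ n))%R.
Proof.
move=> f0 g0 x y; apply: divr_ge0; first exact: mulr_ge0.
by apply: addr_ge0; apply: exprn_ge0; exact: enorm_ge0.
Qed.

Lemma hilbert_formZ (f g : Rn R n -> R) (a b : R) : (forall x, 0 <= f x)%R ->
  (forall x, 0 <= g x)%R -> (0 < a)%R -> (0 < b)%R ->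
  hilbert_form f g <=
    (a * b)%:E * hilbert_form (fun x => f x / a)%R (fun x => g x / b)%R.
Proof.
move=> f0 g0 a0 b0; have ab0 : (0 < a * b)%R by rewrite mulr_gt0.
have fa0 x : (0 <= f x / a)%R by rewrite divr_ge0// ltW.
have gb0 x : (0 <= g x / b)%R by rewrite divr_ge0// ltW.
have h0 := hilbert_integrand_ge0 fa0 gb0.
apply: le_trans (ge0_integralZl_nm _ ab0 _); last first.
  by move=> y; apply: integral_ge0 => x _; rewrite lee_fin.
apply: ge0_le_integral_nm => y _.
  by apply: integral_ge0 => x _; rewrite lee_fin; exact: hilbert_integrand_ge0.
apply: le_trans (ge0_integralZl_nm _ ab0 _); last by move=> x; rewrite lee_fin.
apply: ge0_le_integral_nm => x _; first by rewrite lee_fin; exact: hilbert_integrand_ge0.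
rewrite -EFinM lee_fin [leRHS]mulrA.
by rewrite (_ : a * b * (f x / a * (g y / b)) = f x * g y)%R//; field; rewrite !gt_eqF.
Qed.

Section sufficiency.
Variables (C t0 t1 L : R).
Hypothesis C_gt0 : (0 < C)%R.
Hypothesis AC : forall b : R, (0 < b)%R ->
  gauge mu (eball0 b) q1 v1 * gauge mu (eball0 b) q2 v2 <= (C * b ^+ n)%:E.
Hypotheses (t0_itv : (0 <= t0 <= 1)%R) (t1_itv : (0 <= t1 <= 1)%R).
Hypothesis tL1 : forall j x, annulus j x ->
  (`|1 - (if j < 0 then t0 else t1) * q1 x| * `|j|%N%:R <= L)%R.
Hypothesis tL2 : forall j x, annulus j x ->
  (`|1 - (1 - if j < 0 then t0 else t1) * q2 x| * `|j|%N%:R <= L)%R.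

Let AC' (b : R) : (0 < b)%R ->
  gauge mu (eball0 b) q2 v2 * gauge mu (eball0 b) q1 v1 <= (C * b ^+ n)%:E.
Proof. by rewrite muleC; exact: AC. Qed.

Lemma hilbert_form_bounded : exists2 K : R, (0 < K)%R &
  forall f g : Rn R n -> R, measurable_fun setT f -> measurable_fun setT g ->
  (forall x, 0 <= f x)%R -> (forall x, 0 <= g x)%R ->
  gauge mu setT q1 (fun x => f x * v1 x)%R < +oo ->
  gauge mu setT q2 (fun x => g x * v2 x)%R < +oo ->
  hilbert_form f g <= K%:E * gauge mu setT q1 (fun x => f x * v1 x)%R
                           * gauge mu setT q2 (fun x => g x * v2 x)%R.
Proof.
have C20 : (0 <= C * 2 ^+ n)%R by rewrite mulr_ge0 ?(ltW C_gt0)// exprn_ge0.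
have main := @hilbert_form_le R n n_gt0 q1 q2 v1 v2 (C * 2 ^+ n)%R (ball_ratio n Q C)
  mq1 mq2 q1_ge1 q2_ge1 q12 mv1 mv2 v1_gt0 v2_gt0 v12 C20
  (ball_gauge q1 v1) (ball_gauge q2 v2).
have gE := ball_gaugeE n_gt0 mq1 mq2 q1_ge1 q2_ge1 mv1 mv2 v1_gt0 v2_gt0 AC.
have mU1 := ball_gauge_modular n_gt0 mq2 mq1 q2_ge1 q1_ge1 q1Q mv2 mv1 v2_gt0 v1_gt0 AC'.
have mU2 := ball_gauge_modular n_gt0 mq1 mq2 q1_ge1 q2_ge1 q2Q mv1 mv2 v1_gt0 v2_gt0 AC.
have U1 j : (0 < ball_gauge q1 v1 j)%R by have [] := gE j.
have U2 j : (0 < ball_gauge q2 v2 j)%R by have [] := gE j.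
have U12 j : (ball_gauge q1 v1 j * ball_gauge q2 v2 j <= C * 2 ^+ n * dyadic R j ^+ n)%R.
  by have [] := gE j.
have r01 : (0 < ball_ratio n Q C < 1)%R by exact: ball_ratio_itv q1Q C_gt0.
have dec1 := ball_gauge_decay n_gt0 mq2 mq1 q2_ge1 q1_ge1 q2Q q1Q q21 mv2 mv1
    v2_gt0 v1_gt0 v21 C_gt0 AC'.
have dec2 := ball_gauge_decay n_gt0 mq1 mq2 q1_ge1 q2_ge1 q1Q q2Q q12 mv1 mv2
    v1_gt0 v2_gt0 v12 C_gt0 AC.
have {main}main := main U1 U2 mU1 mU2 U12 r01 dec1 dec2 t0 t1 L t0_itv t1_itv tL1 tL2.
set K0 := hilbert_constant _ _ _ in main.
(* Read off by applying the bound to the zero functions. *)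
have K0_ge0 : (0 <= K0)%R.
  rewrite -lee_fin; apply: le_trans (main (cst 0%R) (cst 0%R) _ _ _ _ _ _) => //.
  - by apply: integral_ge0 => y _; apply: integral_ge0 => x _; rewrite lee_fin !mul0r.
  - rewrite /modular integral0_eq// => x _; rewrite mul0r powR0// gt_eqF//.
    exact: lt_le_trans (q1_ge1 x).
  - rewrite /modular integral0_eq// => x _; rewrite mul0r powR0// gt_eqF//.
    exact: lt_le_trans (q2_ge1 x).
exists (K0 + 1)%R; first by rewrite ltr_wpDl.
move=> f g mf mg f0 g0.
have := gauge_ge0 mu setT q1 (fun x => f x * v1 x)%R.
have := gauge_ge0 mu setT q2 (fun x => g x * v2 x)%R.
case Ef : (gauge mu setT q1 _) => [a||] //; case Eg : (gauge mu setT q2 _) => [b||] //.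
rewrite !lee_fin => b0 a0 _ _; rewrite -!EFinM.
(* Dividing [f] and [g] by [l] and [m] makes both modulars at most 1. *)
apply: mulr_le_approx => // [|l m al bm]; first by rewrite addr_ge0.
have l0 : (0 < l)%R by exact: le_lt_trans al.
have m0 : (0 < m)%R by exact: le_lt_trans bm.
apply: le_trans (hilbert_formZ f0 g0 l0 m0) _.
have fl : modular mu setT q1 (fun x => f x / l * v1 x)%R <= 1.
  rewrite (_ : (fun x => _) = (fun x => f x * v1 x / l)%R); last first.
    by apply/funext => x; rewrite mulrAC.
  apply: modular_gauge_lt; last by rewrite Ef lte_fin.
  - by move=> x _; rewrite (le_trans _ (q1_ge1 x)).
  - by move=> x _; rewrite mulr_ge0// ltW.
have gm : modular mu setT q2 (fun x => g x / m * v2 x)%R <= 1.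
  rewrite (_ : (fun x => _) = (fun x => g x * v2 x / m)%R); last first.
    by apply/funext => x; rewrite mulrAC.
  apply: modular_gauge_lt; last by rewrite Eg lte_fin.
  - by move=> x _; rewrite (le_trans _ (q2_ge1 x)).
  - by move=> x _; rewrite mulr_ge0// ltW.
have lm0 : (0 <= l * m)%R by rewrite mulr_ge0// ltW.
have H : hilbert_form (fun x => f x / l)%R (fun x => g x / m)%R <= K0%:E.
  apply: main.
  - exact: measurable_funM mf (measurable_cst _).
  - exact: measurable_funM mg (measurable_cst _).
  - by move=> x; rewrite divr_ge0// ltW.
  - by move=> x; rewrite divr_ge0// ltW.
  - exact: fl.
  - exact: gm.
apply: le_trans (lee_wpmul2l _ H) _; first by rewrite lee_fin.
rewrite -EFinM lee_fin -mulrA mulrC ler_wpM2r// lerDl//.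
Qed.

End sufficiency.

(** Extremizers [f] and [g] for the two gauges live on [B], where the kernel is at least 1/(2 b^n),
    so l1 l2 / (2 b^n) is at most the form, hence at most C. The origin is removed because at x = y
    = 0 the kernel is the inverse of 0, which is 0. *)
Lemma ball_gauges_le (C b : R) : (0 < C)%R -> (0 < b)%R ->
  (forall f g : Rn R n -> R, measurable_fun setT f -> measurable_fun setT g ->
    (forall x, 0 <= f x)%R -> (forall x, 0 <= g x)%R ->
    gauge mu setT q1 (fun x => f x * v1 x)%R <= 1 ->
    gauge mu setT q2 (fun x => g x * v2 x)%R <= 1 ->
    hilbert_form f g <= C%:E) ->
  gauge mu (eball0 b `\` [set x | enorm x = 0%R]) q1 v1 *
  gauge mu (eball0 b `\` [set x | enorm x = 0%R]) q2 v2 <= (2 * C * b ^+ n)%:E.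
Proof.
move=> C0 b0 H; set B := _ `\` _.
have mB : measurable B.
  apply: measurableD; first exact: measurable_eball0.
  rewrite -[X in measurable X]setTI.
  exact: (@measurable_enorm R n measurableT [set 0%R] (measurable_set1 0%R)).
have bn0 : (0 < b ^+ n)%R by rewrite exprn_gt0.
apply: mule_le_approx; try exact: gauge_ge0.
  by rewrite !mulr_ge0// ltW.
move=> l1 l2 l10 l20 hl1 hl2.
have [f [mf f0 fB fm fl]] := gauge_extremizer mq1 mq2 q1_ge1 q2_ge1 q12 mB mv1 mv2
  v1_gt0 v2_gt0 v12 q2Q l20 hl2.
have [g [mg g0 gB gm gl]] := gauge_extremizer mq2 mq1 q2_ge1 q1_ge1 q21 mB mv2 mv1
  v2_gt0 v1_gt0 v21 q1Q l10 hl1.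
have c0 : (0 < (2 * b ^+ n)^-1)%R by rewrite invr_gt0 mulr_gt0.
have := H f g mf mg f0 g0 fm gm.
have h0 := hilbert_integrand_ge0 f0 g0.
have inner y : B y -> ((2 * b ^+ n)^-1 * l2)%:E * (g y)%:E <=
    \int[mu]_x (f x * g y / (enorm x ^+ n + enorm y ^+ n))%:E.
  move=> [yb /= /eqP y0].
  have k0 : (0 <= (2 * b ^+ n)^-1 * g y)%R by rewrite mulr_ge0// ltW.
  apply: (@le_trans _ _ (((2 * b ^+ n)^-1 * g y)%:E * \int[mu]_(x in B) (f x)%:E)).
    apply: le_trans (lee_wpmul2l _ fl); last by rewrite lee_fin.
    by rewrite -!EFinM lee_fin mulrAC.
  rewrite -ge0_integralZl_EFin//; last 2 first.
  - by move=> x _; rewrite lee_fin.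
  - by apply: measurable_funTS; exact/measurable_EFinP.
  rewrite integral_mkcond; apply: ge0_le_integral_nm => x _.
    by apply: erestrict_ge0 => z _; rewrite -EFinM lee_fin mulr_ge0.
  rewrite patchE; case: ifPn => [/set_mem [xb _]|_]; last by rewrite lee_fin.
  rewrite -EFinM lee_fin (_ : (2 * b ^+ n)^-1 * g y * f x =
    f x * g y * (2 * b ^+ n)^-1)%R; last by ring.
  apply: ler_wpM2l; first exact: mulr_ge0.
  have y0' : (0 < enorm y)%R by rewrite lt_neqAle enorm_ge0 eq_sym y0.
  have sum0 : (0 < enorm x ^+ n + enorm y ^+ n)%R.
    by rewrite ltr_wpDl ?exprn_gt0// exprn_ge0// enorm_ge0.
  rewrite lef_pV2 ?posrE ?mulr_gt0// mulr2n mulrDl !mul1r.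
  by apply: lerD; rewrite lerXn2r ?nnegrE ?enorm_ge0 ?(ltW b0)// ltW.
move=> HC.
have {HC} : ((2 * b ^+ n)^-1 * l2)%:E * l1%:E <= C%:E.
  apply: le_trans HC.
  apply: (@le_trans _ _
    (((2 * b ^+ n)^-1 * l2)%:E * \int[mu]_(y in B) (g y)%:E)).
    by apply: lee_wpmul2l => //; rewrite lee_fin mulr_ge0// ltW.
  rewrite -ge0_integralZl_EFin//; last 3 first.
  - by move=> x _; rewrite lee_fin.
  - by apply: measurable_funTS; exact/measurable_EFinP.
  - by rewrite mulr_ge0// ltW.
  rewrite integral_mkcond; apply: ge0_le_integral_nm => y _.
    apply: erestrict_ge0 => z _; rewrite -EFinM lee_fin mulr_ge0//.
    by rewrite mulr_ge0// ltW.
  rewrite patchE; case: ifPn => [/set_mem|_]; first exact: inner.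
  by apply: integral_ge0 => x _; rewrite lee_fin.
rewrite -EFinM lee_fin => H12.
have {H12} : (l2 * l1 <= 2 * b ^+ n * C)%R by rewrite -ler_pdivrMl ?mulr_gt0// mulrA.
by rewrite mulrC mulrAC.
Qed.

(** Both sides are [vnorm] of the same function, as the two indicators differ at most at the origin,
    a null set. *)
Lemma gauge_setD_origin (q v : Rn R n -> R) (B : set (Rn R n)) :
  (forall x, 0 < q x)%R -> (forall x, 0 <= v x)%R ->
  gauge mu (B `\` [set x | enorm x = 0%R]) q v = gauge mu B q v.
Proof.
move=> q0 v0; pose h x := (v x * \1_B x)%:E.
rewrite -(@vnorm_gauge R n q h v B)//; last exact: aeW.
apply/esym/vnorm_gauge => //.
exists [set x | enorm x = 0%R]; split.
- rewrite -[X in measurable X]setTI.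
  exact: (@measurable_enorm R n measurableT [set 0%R] (measurable_set1 0%R)).
- exact: lebesgue_origin.
- move=> x /= H; apply: contrapT => x0; apply: H; rewrite /h !indicE.
  congr (_ * (nat_of_bool _)%:R)%:E.
  by apply/idP/idP => /set_mem xB; apply/mem_set; [split|case: xB].
Qed.

End hilbert_gauge.

Theorem theorem1p13 (R : realType) (n : nat) (n_gt0 : (0 < n)%N)
    (p : Rn R n -> R) (w : Rn R n -> \bar R)
    (p_exp : is_exponent p) (p_LH0 : LH0 p) (p_LHoo : LHoo p)
    (p_inf : 1 < exponent_inf p) (p_inf_sup : exponent_inf p <= exponent_sup p)
    (p_sup : exponent_sup p < +oo) (w_weight : weight w) :
  (exists2 C : R, (0 < C)%R &
    forall f g : Rn R n -> R,
      (forall x, (0 <= f x)%R) -> (forall y, (0 <= g y)%R) ->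
      in_wLp p w f -> in_wLp (conjugate p) (fun y => (w y)^-1) g ->
      \int[lebesgue R n]_y \int[lebesgue R n]_x
        (f x * g y / (enorm x ^+ n + enorm y ^+ n))%:E
      <= C%:E * vnorm p (fun x => (f x)%:E * w x)
              * vnorm (conjugate p) (fun y => (g y)%:E * (w y)^-1))
  <-> Ap0 p w.
Proof.
have [mp p_ge1 [P pP]] := p_exp.
have {}pP x : (p x <= P)%R by apply: pP; exists x.
have [a a1 ap] := exponent_inf_gt1 p_ge1 p_inf.
have p_gt1 x : (1 < p x)%R by exact: lt_le_trans (ap x).
have p'_bnd x := conjugate_bounds a1 (ap x).
have p'_ge1 x : (1 <= conjugate p x)%R by have /andP[] := p'_bnd x.
have p_gt0 x : (0 < p x)%R by exact: lt_trans (p_gt1 x).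
have p'_gt0 x : (0 < conjugate p x)%R by exact: lt_le_trans (p'_ge1 x).
(* A common upper bound for the exponent and its conjugate. *)
pose Q := Num.max P (a / (a - 1))%R.
have pQ x : (p x <= Q)%R by rewrite le_max pP.
have p'Q x : (conjugate p x <= Q)%R.
  by have /andP[_ h] := p'_bnd x; rewrite le_max h orbT.
have mp' := measurable_conjugate mp p_gt1.
have pp' x := conjugate_sum (p_gt1 x).
have [v1 [v2 [mv1 mv2 v_gt0 v12 wv]]] := real_weight w_weight.
have v1_gt0 x : (0 < v1 x)%R by have [] := v_gt0 x.
have v2_gt0 x : (0 < v2 x)%R by have [] := v_gt0 x.
have fE (f : Rn R n -> R) : (forall x, (0 <= f x)%R) ->
    vnorm p (fun x => (f x)%:E * w x) =
    gauge (lebesgue R n) setT p (fun x => f x * v1 x)%R.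
  move=> f0; apply: vnorm_gauge => //; first by move=> x; rewrite mulr_ge0// ltW.
  by apply: filterS wv => x [-> _]; rewrite indicT mulr1 EFinM.
have gE (g : Rn R n -> R) : (forall x, (0 <= g x)%R) ->
    vnorm (conjugate p) (fun x => (g x)%:E * (w x)^-1) =
    gauge (lebesgue R n) setT (conjugate p) (fun x => g x * v2 x)%R.
  move=> g0; apply: vnorm_gauge => //; first by move=> x; rewrite mulr_ge0// ltW.
  by apply: filterS wv => x [_ ->]; rewrite indicT mulr1 EFinM.
have wE (b : R) : vnorm p (fun x => w x * (\1_(eball0 b) x)%:E) =
    gauge (lebesgue R n) (eball0 b) p v1.
  apply: vnorm_gauge => //; first by move=> x; exact: ltW.
  by apply: filterS wv => x [-> _]; rewrite -EFinM.
have wE' (b : R) : vnorm (conjugate p) (fun x => (w x)^-1 * (\1_(eball0 b) x)%:E) =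
    gauge (lebesgue R n) (eball0 b) (conjugate p) v2.
  apply: vnorm_gauge => //; first by move=> x; exact: ltW.
  by apply: filterS wv => x [_ ->]; rewrite -EFinM.
split => [[C C0 HC]|[C C0 HC]].
  (* Necessity; the 2 comes from |x|^n + |y|^n <= 2 b^n on the ball. *)
  exists (2 * C)%R; first by rewrite mulr_gt0.
  move=> b b0; rewrite wE wE'.
  rewrite -(gauge_setD_origin n_gt0 _ p_gt0 (fun x => ltW (v1_gt0 x))).
  rewrite -(gauge_setD_origin n_gt0 _ p'_gt0 (fun x => ltW (v2_gt0 x))).
  apply: (ball_gauges_le mp mp' p_ge1 p'_ge1 pQ p'Q pp' mv1 mv2 v1_gt0 v2_gt0 v12 C0 b0).
  move=> f g mf mg f0 g0 fm gm.
  have := HC f g f0 g0 _ _; rewrite fE// gE// => H.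
  apply: le_trans (H _ _) _.
  - by split => //; rewrite fE// (le_lt_trans fm)// ltry.
  - by split => //; rewrite gE// (le_lt_trans gm)// ltry.
  rewrite -muleA -[leRHS]mule1 lee_wpmul2l ?lee_fin ?(ltW C0)//.
  rewrite -[leRHS]mule1.
  exact: lee_pmul (gauge_ge0 _ _ _ _) (gauge_ge0 _ _ _ _) fm gm.
have [C1 [p0 [C10 p01 Hp0]]] := p_LH0.
have [C2 [poo [C20 poo1 Hpoo]]] := p_LHoo.
have pb x : (1 <= p x <= P)%R by rewrite p_ge1 pP.
have [L L0 HL] := log_hoelder_annulus pb C10 p01 C20 Hp0 Hpoo.
have lim1 (j : int) : (1 <= dyadic_limit p0 poo j)%R.
  by rewrite /dyadic_limit; case: ifP.
have tE (j : int) :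
    (if (j < 0)%R then p0^-1 else poo^-1)%R = (dyadic_limit p0 poo j)^-1%R.
  by rewrite /dyadic_limit; case: ifP.
have inv01 (s : R) : (1 <= s)%R -> (0 <= s^-1 <= 1)%R.
  by move=> s1; rewrite invr_ge0 (le_trans _ s1)//= invf_le1// (lt_le_trans _ s1).
have dev j x : annulus j x ->
    (`|1 - (dyadic_limit p0 poo j)^-1 * p x| * `|j|%N%:R
        <= L * (1 + (a - 1)^-1))%R /\
    (`|1 - (1 - (dyadic_limit p0 poo j)^-1) * conjugate p x| * `|j|%N%:R
        <= L * (1 + (a - 1)^-1))%R.
  move=> jx; rewrite conjugateE//; apply: exponent_deviation => //.
  exact: HL.
have AC b (b0 : (0 < b)%R) : gauge (lebesgue R n) (eball0 b) p v1 *
    gauge (lebesgue R n) (eball0 b) (conjugate p) v2 <= (C * b ^+ n)%:E.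
  by rewrite -wE -wE'; exact: HC.
(* [dev] is restated with the reciprocals inside the conditional, the form in which
   [hilbert_form_bounded] takes t0 = 1/p0 and t1 = 1/poo. *)
have dev1 j x (jx : annulus j x) := eq_ind_r (fun t => `|1 - t * p x| * _ <= _)%R
  (dev j x jx).1 (tE j).
have dev2 j x (jx : annulus j x) := eq_ind_r
  (fun t => `|1 - (1 - t) * conjugate p x| * _ <= _)%R (dev j x jx).2 (tE j).
have [K K0 HK] := hilbert_form_bounded n_gt0 mp mp' p_ge1 p'_ge1 pQ p'Q pp'
  mv1 mv2 v1_gt0 v2_gt0 v12 C0 AC (inv01 _ p01) (inv01 _ poo1) dev1 dev2.
exists K => // f g f0 g0 [mf fm] [mg gm].
rewrite fE// gE//; apply: HK => //; first by rewrite -fE.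
by rewrite -gE.
Qed.
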